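(* Let $p>1$, let $Q\subseteq\mathbb{R}^n$ be a fixed dyadic cube, and let $f,F$ be real numbers with $f>0$ and $0<f^p\le F$. If $(\phi_k)_{k\ge1}$ and $(g_k)_{k\ge1}$ are extremal sequences for the Bellman function $T_p(f,F)$, then $\phi_k-g_k\to 0$ weakly in $L^p(\mathbb{R}^n)$ as $k\to\infty$; that is, with $\frac1p+\frac1q=1$, $$\lim_{k\to\infty}\int_Q(\phi_k-g_k)\,h\,du=0\qquad\text{for every } h\in L^q(Q).$$
   Context: $|\cdot|$ is Lebesgue measure on $\mathbb{R}^n$, and the dyadic cubes are those formed by the grids $2^{-N}\mathbb{Z}^n$, $N=0,1,2,\ldots$. The dyadic maximal operator is $$\mathcal{M}_d\phi(x)=\sup\Big\{\frac{1}{|R|}\int_R|\phi(u)|\,du : x\in R,\ R\subseteq\mathbb{R}^n\text{ is a dyadic cube}\Big\}.$$ For $p>1$, a fixed dyadic cube $Q$ and $0<f^p\le F$, the Bellman function is $$T_p(f,F)=\sup\Big\{\frac{1}{|Q|}\int_Q(\mathcal{M}_d\phi)^p : \phi\ge 0,\ \frac{1}{|Q|}\int_Q\phi(u)\,du=f,\ \frac{1}{|Q|}\int_Q\phi^p(u)\,du=F\Big\}.$$ A sequence $(\phi_k)_k$ of non-negative measurable functions is called extremal for $T_p(f,F)$ if $\frac{1}{|Q|}\int_Q\phi_k\,du=f$ and $\frac{1}{|Q|}\int_Q\phi_k^p\,du=F$ for every $k$, and $\lim_{k\to\infty}\frac{1}{|Q|}\int_Q(\mathcal{M}_d\phi_k)^p\,du=T_p(f,F)$.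 Convention: the functions considered are functions on $Q$, regarded as functions on $\mathbb{R}^n$ vanishing outside $Q$. *)

(* Defs.v *)
From HB Require Import structures.
From mathcomp Require Import all_boot all_order all_algebra.
From mathcomp Require Import all_classical all_reals all_analysis.

Set Implicit Arguments.
Unset Strict Implicit.
Unset Printing Implicit Defensive.
Import Order.TTheory GRing.Theory Num.Theory.
Import numFieldNormedType.Exports.

Local Open Scope classical_set_scope.
Local Open Scope ring_scope.
Local Open Scope ereal_scope.

Section borel_lebesgue.
Variable R : realType.

Definition cons_pair n (x : measurableTypeR R * n.-tuple (measurableTypeR R)) :
  n.+1.-tuple (measurableTypeR R) := [tuple of x.1 :: x.2].

Lemma measurable_cons_pair n : measurable_fun setT (@cons_pair n).
Proof. by apply: measurable_cons. Qed.

Section step.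
Variables (n : nat)
  (mu : {sigma_finite_measure set (n.-tuple (measurableTypeR R)) -> \bar R}).

Definition tuple_prod : set (n.+1.-tuple (measurableTypeR R)) -> \bar R :=
  pushforward (@lebesgue_measure R \x mu) (@cons_pair n).

Let tuple_prod0 : tuple_prod set0 = 0.
Proof. by rewrite /tuple_prod /pushforward preimage_set0 measure0. Qed.

Let tuple_prod_ge0 A : 0 <= tuple_prod A.
Proof. by rewrite /tuple_prod /pushforward measure_ge0. Qed.

Let tuple_prod_sigma_additive : semi_sigma_additive tuple_prod.
Proof.
move=> F mF tF mUF; rewrite /tuple_prod /pushforward preimage_bigcup.
apply: measure_semi_sigma_additive.
- move=> k; rewrite -[X in measurable X]setTI.
  exact: (@measurable_cons_pair n).
- apply/trivIsetP => /= i j _ _ ij; rewrite -preimage_setI.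
  by move/trivIsetP : tF => /(_ _ _ _ _ ij) ->//; rewrite preimage_set0.
- rewrite -preimage_bigcup -[X in measurable X]setTI.
  exact: (@measurable_cons_pair n).
Qed.

HB.instance Definition _ := isMeasure.Build _ _ _ tuple_prod
  tuple_prod0 tuple_prod_ge0 tuple_prod_sigma_additive.

Let tuple_prod_sigma_finite : sigma_finite setT tuple_prod.
Proof.
have /sigma_finiteP[F [TF ndF Foo]] := sigma_finiteT (@lebesgue_measure R).
have /sigma_finiteP[G [TG ndG Goo]] := sigma_finiteT mu.
pose hd (t : n.+1.-tuple (measurableTypeR R)) := tnth t ord0.
pose tl (t : n.+1.-tuple (measurableTypeR R)) := [tuple of behead t].
exists (fun k => hd @^-1` F k `&` tl @^-1` G k).
  apply/esym; rewrite -subTset => t _.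
  have [i _ Fi] : (\bigcup_i F i) (hd t) by rewrite -TF.
  have [j _ Gj] : (\bigcup_i G i) (tl t) by rewrite -TG.
  exists (maxn i j) => //; split.
    have /subsetPset := ndF _ _ (leq_maxl i j); exact.
  have /subsetPset := ndG _ _ (leq_maxr i j); exact.
move=> k; have [mF Fk] := Foo k; have [mG Gk] := Goo k; split.
  apply: measurableI.
    by rewrite -[X in measurable X]setTI; exact: measurable_tnth.
  by rewrite -[X in measurable X]setTI; exact: measurable_behead.
rewrite /tuple_prod /pushforward.
rewrite (_ : _ @^-1` _ = F k `*` G k).
  by rewrite product_measure1E// lte_mul_pinfty// ge0_fin_numE.
have tlK a t : tl (cons_pair (a, t)) = t by exact: val_inj.
by apply/seteqP; split => -[a t]; rewrite /= tlK.
Qed.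

HB.instance Definition _ := Measure_isSigmaFinite.Build _ _ _ tuple_prod
  tuple_prod_sigma_finite.

End step.

(* Lebesgue measure on the Borel sets of R^n: the n-fold product of
   one-dimensional Lebesgue measure, transported to tuples. *)
Fixpoint borel_lebesgue n :
    {sigma_finite_measure set (n.-tuple (measurableTypeR R)) -> \bar R} :=
  match n with
  | 0 => \d_ ([tuple] : 0.-tuple (measurableTypeR R))
  | n.+1 => tuple_prod (borel_lebesgue n)
  end.

(* Caratheodory's sigma-algebra is that of all Lebesgue measurable sets, i.e.
   the completion of the Borel sigma-algebra on tuples. *)
Definition Rn n := caratheodory_type (borel_lebesgue n)^*%mu.
HB.instance Definition _ n := Measurable.on (Rn n).

Definition lebesgue n : set (Rn n) -> \bar R :=
  @completed_measure_extension _ _ _ (borel_lebesgue n).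
HB.instance Definition _ n := Measure.on (@lebesgue n).

End borel_lebesgue.

Section bellman.
Variables (R : realType) (n : nat).
Local Notation mu := (@lebesgue R n).

(* Half-open cubes, so that those of a given generation partition R^n. *)
Definition dyadic_cube (N : nat) (z : 'I_n -> int) : set (Rn R n) :=
  [set x | forall i, ((z i)%:~R / 2 ^+ N <= tnth x i < (z i + 1)%:~R / 2 ^+ N)%R].

Definition is_dyadic_cube (Q : set (Rn R n)) := exists N z, Q = dyadic_cube N z.

Definition average (Q : set (Rn R n)) (g : Rn R n -> \bar R) : \bar R :=
  (mu Q)^-1 * \int[mu]_(u in Q) g u.

Definition dyadic_maximal (phi : Rn R n -> R) (x : Rn R n) : \bar R :=
  ereal_sup [set average P (fun u => `|phi u|%:E) |
             P in [set P | is_dyadic_cube P /\ P x]].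

(* The functions competing in the definition of T_p(f, F): functions on Q,
   extended by 0 outside Q. *)
Definition admissible (p : R) (Q : set (Rn R n)) (f F : R)
    (phi : Rn R n -> R) :=
  [/\ measurable_fun setT phi,
      (forall x, 0 <= phi x)%R,
      (forall x, ~ Q x -> phi x = 0%R),
      average Q (fun u => (phi u)%:E) = f%:E &
      average Q (fun u => (phi u `^ p)%:E) = F%:E].

Definition maximal_average (p : R) (Q : set (Rn R n)) (phi : Rn R n -> R) :=
  average Q (fun u => dyadic_maximal phi u `^ p).

(* T_p(f, F) *)
Definition bellman (p : R) (Q : set (Rn R n)) (f F : R) : \bar R :=
  ereal_sup [set maximal_average p Q phi | phi in admissible p Q f F].

Definition extremal (p : R) (Q : set (Rn R n)) (f F : R)
    (phi : nat -> Rn R n -> R) :=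
  (forall k, admissible p Q f F (phi k)) /\
  maximal_average p Q (phi k) @[k --> \oo] --> bellman p Q f F.

End bellman.

(* Main.v *)
Require Import Defs.
From mathcomp Require Import all_boot all_order all_algebra.
From mathcomp Require Import all_classical all_reals all_analysis.
From mathcomp Require Import measurable_realfun.
From mathcomp Require Import ring lra.
Import Order.TTheory GRing.Theory Num.Theory.
Import numFieldNormedType.Exports.
Set Implicit Arguments.
Unset Strict Implicit.
Unset Printing Implicit Defensive.
Local Open Scope classical_set_scope.
Local Open Scope ring_scope.

(** With [H(z) = p z^(p-1) - (p-1) z^p] let [om >= 1] solve
    [H(om) = f^p / F]. Along the dyadic filtration of [Q], let [y] be the
    average of [phi] on the current cube and [M] the largest average met so
    far. The quantity [(p-1) M^p - p y M^(p-1)] has nonincreasing expectation;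
    a step from a cube with running maximum [M] to a subcube with average
    [y > M] loses exactly [y^p - p y M^(p-1) + (p-1) M^p > 0] there. With
    Young's inequality at the final step this gives
      [(p-1) (1 - 1/om) A + (losses) <= (p-1) (1 - 1/om) F om^p]
    for the average [A] of [(M_d phi)^p]. Explicit functions show that
    [T_p(f, F) >= F om^p] when [om > 1], so along an extremal sequence the
    losses tend to [0] (when [om = 1] they vanish identically). By induction
    on the generation, the average over every dyadic subcube of [Q] therefore
    has limsup at most [f], hence tends to [f] since the averages over
    siblings average out to that of the parent. An [L^p]-bounded sequence whose
    integrals over all dyadic subcubes tend to [0] is weakly null. *)

(** * Dyadic cubes *)

(** With [l > 1] left free, Young's inequality bounds the average [A] by
    [(l^(p-1) F - f^p) / ((p-1) (1 - 1/l))]. Its derivative in [l] vanishes exactly when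
    [H(l) = f^p / F]: this is the origin of [om], and the bound there is [F om^p]. A large average
    on a subcube is penalised only if it exceeds the running maximum, so a large average over an
    ancestor could hide it. Hence the induction on the generation: once the averages over all proper
    ancestors are near [f], the running maximum on arrival is near [f] too, and an average of at
    least [f + e] loses a fixed positive amount. Small averages cause no loss, which is why the
    bound from below has to come from the siblings. For the lower bound on [T_p], self-similar
    functions are built whose averages over suitable cubes are a constant multiple of their value at
    a point, so that [M_d phi >= W phi]; [W] can be taken as close to [om] as desired. *)

Section box.
Variable R : realType.

Definition box {n} (a b : 'I_n -> R) : set (n.-tuple (measurableTypeR R)) :=
  [set x | forall i, a i <= tnth x i < b i].

Lemma measurable_box n (a b : 'I_n -> R) : measurable (box a b).
Proof.
rewrite (_ : box a b = \bigcap_(i in [set: 'I_n])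
    (@tnth n (measurableTypeR R) ^~ i) @^-1` `[a i, b i[%classic).
  apply: fin_bigcap_measurable; first exact: finite_finset.
  move=> i _; rewrite -[X in measurable X]setTI.
  by apply: measurable_tnth => //; exact: measurable_itv.
apply/seteqP; split => x /= h i.
  by move=> _; rewrite /= in_itv/=; exact: h.
by have := h i I; rewrite /= in_itv.
Qed.

Lemma borel_lebesgue_box n (a b : 'I_n -> R) : (forall i, a i <= b i) ->
  borel_lebesgue R n (box a b) = (\prod_i (b i - a i))%:E.
Proof.
elim: n a b => [|n IH] a b ab.
  rewrite big_ord0 /= diracE mem_set//.
  by case.
pose a' i := a (lift ord0 i); pose b' i := b (lift ord0 i).
rewrite /= /tuple_prod /pushforward.
rewrite (_ : _ @^-1` _ = `[a ord0, b ord0[%classic `*` box a' b').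
  rewrite product_measure1E//; last exact: measurable_box.
  rewrite -[X in (X * _)%E]/(lebesgue_measure `[a ord0, b ord0[%classic) lebesgue_measure_itv.
  rewrite /= IH//; last by move=> i; exact: ab.
  rewrite lte_fin big_ord_recl.
  case: ltP => [_|ba]; first by rewrite EFinM.
  have -> : b ord0 - a ord0 = 0 by apply/eqP; rewrite subr_eq0 eq_le ba ab.
  by rewrite mul0r mul0e.
apply/seteqP; split => -[x t] /=.
  move=> h; split; first by rewrite in_itv/=; exact: (h ord0).
  move=> i; have := h (lift ord0 i).
  by rewrite /cons_pair /= tnthS.
move=> [/=]; rewrite in_itv/= => h0 h i.
case: (unliftP ord0 i) => [j ->|->]; last by [].
by rewrite /cons_pair /= tnthS; exact: h.
Qed.

End box.


Section cubes.
Variables (R : realType) (n : nat).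
Local Notation mu := (@lebesgue R n).
Implicit Types (x : Rn R n) (z : 'I_n -> int).

Lemma pow2_gt0 N : 0 < 2 ^+ N :> R.
Proof. exact: exprn_gt0. Qed.
Hint Extern 0 (is_true (0 < 2 ^+ _)) => exact: pow2_gt0 : core.

Lemma floor_pow2 (y : R) N m :
  Num.floor (y * 2 ^+ N) = (Num.floor (y * 2 ^+ (N + m)%N) %/ (2 ^ m)%N)%Z.
Proof.
set k := Num.floor (y * 2 ^+ (N + m)%N).
have p2 : (0 < (2 ^ m)%N%:Z :> int) by rewrite ltz_nat expn_gt0.
have e2 : ((2 ^ m)%N%:Z)%:~R = 2 ^+ m :> R by rewrite -pmulrn natrX.
apply: floor_def; apply/andP; split.
  rewrite -(ler_pM2r (pow2_gt0 m)) -mulrA -exprD -e2 -intrM.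
  apply: le_trans (floor_le _); rewrite ler_int.
  by rewrite -/k {2}(divz_eq k (2 ^ m)%N) lerDl modz_ge0// gt_eqF.
rewrite -(ltr_pM2r (pow2_gt0 m)) -mulrA -exprD -e2 -intrM.
apply: lt_le_trans (floorD1_gt _) _; rewrite ler_int.
rewrite -/k {1}(divz_eq k (2 ^ m)%N) mulrDl mul1r -addrA lerD2l.
by rewrite lezD1 ltz_pmod.
Qed.

(* The index of the cube of generation [N] containing [x]. *)
Definition gidx N x : 'I_n -> int := fun i => Num.floor (tnth x i * 2 ^+ N).

Lemma dyadic_cubeE N z x : dyadic_cube N z x <-> gidx N x = z.
Proof.
split=> [h|<- i]; last first.
  by rewrite ler_pdivrMr// ltr_pdivlMr// floor_itv.
apply/funext => i; apply: floor_def.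
by rewrite -ler_pdivrMr// -ltr_pdivlMr//; exact: h.
Qed.

Lemma dyadic_cube_gidx N x : dyadic_cube N (gidx N x) x.
Proof. exact/dyadic_cubeE. Qed.

Lemma gidx_coarsen N m x : gidx N x = fun i => (gidx (N + m) x i %/ (2 ^ m)%N)%Z.
Proof. by apply/funext => i; rewrite /gidx (floor_pow2 _ N m). Qed.

Lemma gidx_le {N M x y} : (N <= M)%N -> gidx M x = gidx M y -> gidx N x = gidx N y.
Proof. by move=> NM e; rewrite !(gidx_coarsen N (M - N)) subnKC// e. Qed.

(** The descendants [m] generations down are indexed by a finite type of remainders modulo [2 ^ m],
    so that splittings become sums over [w]. The tree estimates use [m = 1], the functions of the
    lower bound a general [m]. *)
Definition subcube m z (w : {ffun 'I_n -> 'I_(2 ^ m)}) : 'I_n -> int :=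
  fun i => z i * (2 ^ m)%N + (w i : nat).
Arguments subcube m z w : clear implicits.

Lemma subcube_inj m z : injective (subcube m z).
Proof.
move=> w w' /(congr1 (fun u => u _)) e; apply/ffunP => i; apply/val_inj.
by have := e i; rewrite /subcube => /addrI [].
Qed.

Lemma subcube_div m z w : (fun i => (subcube m z w i %/ (2 ^ m)%N)%Z) = z.
Proof.
apply/funext => i; rewrite /subcube divzMDl; last by rewrite gt_eqF// ltz_nat expn_gt0.
by rewrite divz_small ?addr0// lez_nat ltz_nat ltn_ord.
Qed.

Lemma gidx_subcube N m x : exists w, gidx (N + m) x = subcube m (gidx N x) w.
Proof.
have p2 : (0 < (2 ^ m)%N%:Z :> int) by rewrite ltz_nat expn_gt0.
have h i : (`|(gidx (N + m) x i %% (2 ^ m)%N)%Z| < 2 ^ m)%N.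
  by rewrite -ltz_nat gez0_abs ?ltz_pmod// modz_ge0// gt_eqF.
exists [ffun i => Ordinal (h i)].
apply/funext => i; rewrite /subcube ffunE /= gez0_abs ?modz_ge0 ?gt_eqF//.
by rewrite (gidx_coarsen N m) -divz_eq.
Qed.

Lemma dyadic_cube_sub N m z w :
  @dyadic_cube R n (N + m) (subcube m z w) `<=` dyadic_cube N z.
Proof.
move=> x /dyadic_cubeE e; apply/dyadic_cubeE.
by rewrite (gidx_coarsen N m) e subcube_div.
Qed.

Lemma dyadic_cube_split N m z :
  @dyadic_cube R n N z =
  \big[setU/set0]_(w : {ffun 'I_n -> 'I_(2 ^ m)}) dyadic_cube (N + m) (subcube m z w).
Proof.
rewrite -bigcup_seq; apply/seteqP; split => x.
  move=> /dyadic_cubeE e; have [w ew] := gidx_subcube N m x.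
  by exists w; [rewrite /= mem_index_enum | apply/dyadic_cubeE; rewrite ew e].
by move=> [w _ /=]; exact: dyadic_cube_sub.
Qed.

Lemma dyadic_cube_trivIset N m z (D : set _) :
  trivIset D (fun w => @dyadic_cube R n (N + m) (subcube m z w)).
Proof.
by move=> w w' _ _ [x [/dyadic_cubeE e /dyadic_cubeE]]; rewrite e => /subcube_inj.
Qed.

Definition vol N : R := (2 ^+ N)^-1 ^+ n.

Lemma vol_gt0 N : 0 < vol N.
Proof. by rewrite exprn_gt0// invr_gt0. Qed.

Lemma vol_le1 N : vol N <= 1.
Proof.
by rewrite exprn_ile1 ?invr_ge0 ?exprn_ge0// invf_le1// exprn_ege1// ler1n.
Qed.

Lemma volD N m : vol (N + m) = vol N * vol m.
Proof. by rewrite /vol exprD invfM exprMn. Qed.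

Lemma card_subcube m : #|{ffun 'I_n -> 'I_(2 ^ m)}|%:R * vol m = 1 :> R.
Proof.
by rewrite card_ffun !card_ord !natrX /vol -exprMn divff ?expr1n// gt_eqF.
Qed.

Lemma measurable_borel (A : set (n.-tuple (measurableTypeR R))) :
  measurable A -> measurable (A : set (Rn R n)).
Proof. exact: caratheodory_measurable_mu_ext. Qed.

Lemma lebesgue_borel (A : set (n.-tuple (measurableTypeR R))) :
  measurable A -> mu A = borel_lebesgue R n A.
Proof. by move=> mA; exact: measurable_mu_extE. Qed.

Lemma dyadic_cube_box N z : @dyadic_cube R n N z =
  box (fun i => (z i)%:~R / 2 ^+ N) (fun i => (z i + 1)%:~R / 2 ^+ N).
Proof. by []. Qed.

Lemma measurable_dyadic_cube N z : measurable (@dyadic_cube R n N z).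
Proof. by rewrite dyadic_cube_box; apply: measurable_borel; exact: measurable_box. Qed.

Lemma lebesgue_dyadic_cube N z : mu (dyadic_cube N z) = (vol N)%:E.
Proof.
rewrite dyadic_cube_box lebesgue_borel; last exact: measurable_box.
rewrite borel_lebesgue_box; last first.
  by move=> i; rewrite ler_pM2r ?invr_gt0// ler_int lerDl.
rewrite (eq_bigr (fun=> (2 ^+ N)^-1)) ?prodr_const ?card_ord//.
by move=> i _; rewrite -mulrBl -intrB addrC addKr mul1r.
Qed.

(* The same equation, for the form of [mu] produced by [integral_cst]. *)
Lemma measure_dyadic_cube N z :
  (mu : {measure set (Rn R n) -> \bar R}) (dyadic_cube N z) = (vol N)%:E.
Proof. exact: lebesgue_dyadic_cube. Qed.

Lemma dyadic_cube_nested N M z z' x : (N <= M)%N ->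
  dyadic_cube N z x -> dyadic_cube M z' x -> @dyadic_cube R n M z' `<=` dyadic_cube N z.
Proof.
move=> NM /dyadic_cubeE <- /dyadic_cubeE <- y /dyadic_cubeE e; apply/dyadic_cubeE.
exact: gidx_le e.
Qed.

End cubes.
Arguments subcube {n} m z w.
Arguments vol R n N : clear implicits.


(** * The dyadic Bellman inequality *)

Section young.
Variables (R : realType) (p : R).
Hypothesis p_gt1 : 1 < p.
Implicit Types x y M l : R.

Let p_gt0 : 0 < p. Proof. exact: lt_trans p_gt1. Qed.
Let p1_gt0 : 0 < p - 1. Proof. by rewrite subr_gt0. Qed.

Lemma powR_pred x : 0 <= x -> x * x `^ (p - 1) = x `^ p.
Proof. by move=> x0; rewrite mulr_powRB1. Qed.

Lemma young_powR x y : 0 <= x -> 0 <= y ->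
  p * (x * y `^ (p - 1)) <= x `^ p + (p - 1) * y `^ p.
Proof.
move=> x0 y0.
have p0 : p != 0 by rewrite gt_eqF.
have p10 : p - 1 != 0 by rewrite gt_eqF.
have := @conjugate_powR R x (y `^ (p - 1)) p (p / (p - 1)) x0 (powR_ge0 _ _) p_gt0.
rewrite divr_gt0// -powRrM (_ : (p - 1) * (p / (p - 1)) = p); last by field.
rewrite (_ : p^-1 + (p / (p - 1))^-1 = 1); last by field; apply/andP.
move=> /(_ isT erefl) h.
rewrite -ler_pdivlMl//; apply: le_trans h _.
by rewrite le_eqVlt; apply/orP; left; apply/eqP; field; apply/andP.
Qed.

(** The height of [y^p] above the tangent at [M], that is [y^p - M^p - p M^(p-1) (y - M)]: the
    Bregman divergence of the [p]-th power. *)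
Definition gap M y := y `^ p - p * (y * M `^ (p - 1)) + (p - 1) * M `^ p.

Lemma gap_ge0 M y : 0 <= M -> 0 <= y -> 0 <= gap M y.
Proof. by move=> M0 y0; have := young_powR y0 M0; rewrite /gap; lra. Qed.

Lemma powR_tangent y z : 0 <= y -> 0 <= z ->
  y `^ p + p * (y `^ (p - 1) * (z - y)) <= z `^ p.
Proof.
move=> y0 z0; have := young_powR z0 y0; rewrite -(powR_pred y0).
by set u := y `^ (p - 1); set v := z `^ p; lra.
Qed.

Lemma powR_pred_le x y : 0 <= x -> x <= y -> x `^ (p - 1) <= y `^ (p - 1).
Proof.
by move=> x0 xy; apply: ge0_ler_powR; rewrite ?nnegrE ?(ltW p1_gt0)//; exact: le_trans xy.
Qed.

Lemma powR_pred_lt x y : 0 <= x -> x < y -> x `^ (p - 1) < y `^ (p - 1).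
Proof.
by move=> x0 xy; apply: gt0_ltr_powR; rewrite ?nnegrE//; apply: le_trans (ltW xy).
Qed.

Lemma gap_incr M y z : 0 <= M -> M <= y -> y <= z -> 
  gap M y + p * ((z - y) * (y `^ (p - 1) - M `^ (p - 1))) <= gap M z.
Proof.
move=> M0 My yz; have y0 : 0 <= y by exact: le_trans My.
have z0 : 0 <= z by exact: le_trans yz.
by have := powR_tangent y0 z0; rewrite /gap; lra.
Qed.

Lemma gap_gt0 M y : 0 <= M -> M < y -> 0 < gap M y.
Proof.
(* Started at [M] itself, [gap_incr] has increment zero; started at the midpoint, its increment is
   strictly positive. *)
move=> M0 My; pose c := (M + y) / 2.
have Mc : M < c by rewrite /c; lra.
have cy : c < y by rewrite /c; lra.
apply: lt_le_trans (gap_incr M0 (ltW Mc) (ltW cy)).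
apply: ltr_wpDl; first by rewrite gap_ge0// (le_trans M0)// ltW.
by rewrite mulr_gt0// mulr_gt0// subr_gt0//; exact: powR_pred_lt.
Qed.

(** This allows the actual running maximum and average on a cube to be replaced by fixed thresholds
    [al] and [be]. *)
Lemma gap_le M M' y z : 0 <= M -> M <= M' -> M' <= y -> y <= z ->
  gap M' y <= gap M z.
Proof.
move=> M0 MM' M'y yz; have M'0 : 0 <= M' by exact: le_trans MM'.
have My : M <= y by exact: le_trans M'y.
apply: le_trans (gap_incr M0 My yz).
apply: ler_wpDr.
  by apply: mulr_ge0; [exact: ltW|apply: mulr_ge0; rewrite subr_ge0//; exact: powR_pred_le].
have h : 0 <= p * ((y - M') * (M' `^ (p - 1) - M `^ (p - 1))).
  by apply: mulr_ge0; [exact: ltW|apply: mulr_ge0; rewrite subr_ge0//; exact: powR_pred_le].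
have := young_powR M'0 M0; move: h.
rewrite /gap -(powR_pred M'0) -(powR_pred M0).
by set u := M `^ _; set v := M' `^ _; lra.
Qed.

Definition potential M y := (p - 1) * M `^ p - p * (y * M `^ (p - 1)).

Lemma potential_diag y : 0 <= y -> potential y y = - y `^ p.
Proof. by move=> y0; rewrite /potential powR_pred//; lra. Qed.

Lemma potential_max_lt M y : 0 <= M -> M <= y ->
  potential (Num.max M y) y = potential M y - gap M y.
Proof.
move=> M0 My; rewrite (max_idPr My) potential_diag ?(le_trans M0)//.
by rewrite /potential /gap; lra.
Qed.

Lemma potential_max M y : 0 <= M -> 0 <= y ->
  potential (Num.max M y) y <= potential M y.
Proof.
move=> M0 y0; have /orP[yM|My] := le_total y M; first by rewrite (max_idPl yM).
have := gap_ge0 M0 y0.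
by rewrite potential_max_lt//; lra.
Qed.

(** Young's inequality for [l * y] and [M], divided by [l]. The factor [l] stays free until it is
    set to [om]. *)
Lemma potential_leaf l M y : 0 < l -> 0 <= M -> 0 <= y ->
  (p - 1) * (1 - l^-1) * M `^ p <= l `^ (p - 1) * y `^ p + potential M y.
Proof.
move=> l0 M0 y0; have := young_powR (mulr_ge0 (ltW l0) y0) M0.
rewrite powRM ?(ltW l0)// -(powR_pred (ltW l0)).
rewrite (_ : p * _ = l * (p * (y * M `^ (p - 1)))); last by ring.
rewrite -ler_pdivlMl// mulrDr -!mulrA mulKf ?gt_eqF//.
rewrite /potential; set a := l^-1; set u := M `^ p; set v := y `^ p.
by set w := l `^ _; nra.
Qed.

End young.

Section tree.
Variables (R : realType) (p : R) (n : nat) (a P : nat -> ('I_n -> int) -> R).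
Hypothesis p_gt1 : 1 < p.
Hypothesis a_ge0 : forall N z, 0 <= a N z.
Hypothesis a_split : forall N z,
  vol R n N * a N z = \sum_w vol R n N.+1 * a N.+1 (subcube 1 z w).
Hypothesis P_split : forall N z, P N z = \sum_w P N.+1 (subcube 1 z w).
Hypothesis jensen : forall N z, vol R n N * a N z `^ p <= P N z.

(* The integral of [(max M a_1 ... a_m)^p] over the cube [(N, z)], where [a_j]
   is the average over the cube of generation [N + j] containing the point. *)
Fixpoint max_tree m N z M : R :=
  if m is m'.+1 then
    \sum_w max_tree m' N.+1 (subcube 1 z w) (Num.max M (a N.+1 (subcube 1 z w)))
  else vol R n N * M `^ p.

(** A path down the tree, one binary digit per coordinate at each step. Naming a subcube by its path
    makes its ancestors the prefixes [take i ws]. *)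
Definition descend z (ws : seq {ffun 'I_n -> 'I_(2 ^ 1)}) :=
  foldl (fun z w => subcube 1 z w) z ws.

Lemma vol_split N : vol R n N = \sum_(w : {ffun 'I_n -> 'I_(2 ^ 1)}) vol R n N.+1.
Proof.
by rewrite sumr_const -[RHS]mulr_natl -(addn1 N) volD mulrCA card_subcube mulr1.
Qed.

(** With [M] frozen the potential is affine in [y], hence a martingale along the filtration. *)
Lemma potential_split N z M : vol R n N * potential p M (a N z) =
  \sum_w vol R n N.+1 * potential p M (a N.+1 (subcube 1 z w)).
Proof.
transitivity ((p - 1) * M `^ p * vol R n N - p * M `^ (p - 1) * (vol R n N * a N z)).
  by rewrite /potential; ring.
rewrite a_split vol_split !mulr_sumr -sumrB; apply: eq_bigr => w _.
by rewrite /potential; ring.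
Qed.

Lemma max_tree_le (l : R) m N z (M : R) : 1 <= l -> 0 <= M ->
  (p - 1) * (1 - l^-1) * max_tree m N z M <=
  l `^ (p - 1) * P N z + vol R n N * potential p M (a N z).
Proof.
move=> l1; have l0 : 0 < l by exact: lt_le_trans l1.
elim: m N z M => [|m IH] N z M M0 /=.
  have := potential_leaf p_gt1 l0 M0 (a_ge0 N z).
  move=> /(ler_wpM2l (ltW (vol_gt0 R n N))) h.
  rewrite mulrCA; apply: le_trans h _; rewrite mulrDr lerD2r mulrCA.
  by rewrite ler_wpM2l ?powR_ge0.
rewrite P_split potential_split !mulr_sumr -big_split/=; apply: ler_sum => w _.
apply: le_trans (IH _ _ _ _) _; first by rewrite le_max M0.
by rewrite lerD2l ler_pM2l ?vol_gt0// potential_max.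
Qed.

(* Only the loss incurred at the endpoint of the path [ws] is kept. *)
Lemma max_tree_gap (l al be : R) m N z (M : R) ws :
  1 <= l -> 0 <= M -> M <= al -> al <= be -> (0 < size ws <= m)%N ->
  (forall i, (0 < i < size ws)%N -> a (N + i) (descend z (take i ws)) <= al) ->
  be <= a (N + size ws) (descend z ws) ->
  (p - 1) * (1 - l^-1) * max_tree m N z M + vol R n (N + size ws) * gap p al be <=
  l `^ (p - 1) * P N z + vol R n N * potential p M (a N z).
Proof.
move=> l1; elim: ws m N z M => [//|w ws IH] [//|m] N z M M0 Mal albe /=.
rewrite ltnS => szm proper abe.
rewrite P_split potential_split !mulr_sumr -big_split/=.
rewrite (bigD1 w)//= [leRHS](bigD1 w)//= addrAC; apply: lerD; last first.
  apply: ler_sum => v _; apply: le_trans (max_tree_le _ _ _ l1 _) _.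
    by rewrite le_max M0.
  by rewrite lerD2l ler_pM2l ?vol_gt0// potential_max.
set z' := subcube 1 z w in abe *.
have [ws0|ws_gt0] := posnP (size ws).
  (* The path ends at this child: since [M <= al <= be] and [be] is at most its average, updating
     the maximum loses at least [gap p al be]. *)
  move: abe; rewrite (size0nil ws0)/= addn1 -/z' => abe.
  have Ma : M <= a N.+1 z' by apply: le_trans abe; exact: le_trans albe.
  apply: le_trans (lerD (max_tree_le _ _ _ l1 _) (lexx _)) _.
    by rewrite le_max M0.
  rewrite potential_max_lt// mulrBr -!addrA lerD2l gerDl addrC subr_le0.
  by rewrite ler_pM2l ?vol_gt0// gap_le.
rewrite addnS -addSn.
apply: le_trans (IH m N.+1 z' _ _ _ _ _ _ _) _ => //.
- by rewrite le_max M0.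
(* The child is a proper ancestor of the endpoint, so its average, and with it the new maximum, is
   at most [al]. *)
- rewrite ge_max Mal; have := proper 1%N; rewrite addn1 /= take0 /=; apply.
  by rewrite ltnS.
- by rewrite ws_gt0.
- by move=> i /andP[i0 iw]; rewrite addSnnS; apply: (proper i.+1).
- by rewrite addSnnS.
by rewrite lerD2l ler_pM2l ?vol_gt0// potential_max.
Qed.

End tree.


(** * The maximal function as a limit over generations *)

Section ereal_sup_power.
Variable R : realType.

Lemma poweRK (r : R) (x : \bar R) : r != 0 -> (0 <= x)%E -> ((x `^ r) `^ r^-1)%E = x.
Proof. by move=> r0 x0; rewrite -poweRrM divff// poweRe1. Qed.

Lemma le_poweR (r : R) (x y : \bar R) : 0 <= r -> (0 <= x)%E -> (x <= y)%E ->
  (x `^ r <= y `^ r)%E.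
Proof.
move=> r0 x0 xy; apply: gt0_ler_poweR => //; rewrite in_itv/= ?x0 ?leey//.
by rewrite (le_trans x0).
Qed.

Lemma ereal_sup_poweR (r : R) (S : set (\bar R)) : 0 < r -> S !=set0 ->
  (forall x, S x -> (0 <= x)%E) ->
  ereal_sup [set (x `^ r)%E | x in S] = (ereal_sup S `^ r)%E.
Proof.
move=> r0 [x0 Sx0] S0.
have s0 : (0 <= ereal_sup S)%E by apply: le_trans (ereal_sup_ubound Sx0); exact: S0.
apply/eqP; rewrite eq_le; apply/andP; split.
  apply: ge_ereal_sup => _ [x Sx <-].
  by apply: le_poweR; [exact: ltW|exact: S0|exact: ereal_sup_ubound].
rewrite -[leRHS](@poweRK r^-1) ?invr_eq0 ?gt_eqF// ?invrK; last first.
  by apply: le_trans (ereal_sup_ubound (imageP _ Sx0)); exact: poweR_ge0.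
apply: le_poweR => //; first exact: ltW.
apply: ge_ereal_sup => x Sx; rewrite -[leLHS](@poweRK r) ?gt_eqF//; last exact: S0.
apply: le_poweR; [by rewrite invr_ge0 ltW|exact: poweR_ge0|].
exact/ereal_sup_ubound/imageP.
Qed.

End ereal_sup_power.

Section cube_integrals.
Variables (R : realType) (n : nat).
Local Notation mu := (@lebesgue R n).
Implicit Types (N m : nat) (z : 'I_n -> int) (x : Rn R n).

(** A preimage is a union of cubes of generation [N]. Finite functions serve as indices because they
    form a countable type. *)
Lemma measurable_fun_gidx N (h : ('I_n -> int) -> R) :
  measurable_fun setT (fun x => h (gidx N x)).
Proof.
move=> _ B mB; rewrite setTI.
pose E (z : {ffun 'I_n -> int}) : set (Rn R n) :=
  if h z \in B then dyadic_cube N z else set0.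
rewrite (_ : _ @^-1` _ = \bigcup_z E z).
  apply: countable_bigcupT_measurable => // z; rewrite /E.
  by case: ifP => // _; exact: measurable_dyadic_cube.
apply/seteqP; split => x /=.
  move=> Bx; exists [ffun i => gidx N x i] => //; rewrite /E.
  have -> : [ffun i => gidx N x i] = gidx N x :> ('I_n -> int).
    by apply/funext => i; rewrite ffunE.
  by rewrite mem_set//; exact: dyadic_cube_gidx.
move=> [z _]; rewrite /E; case: ifP => // /set_mem Bz /dyadic_cubeE zx.
by rewrite zx.
Qed.

Lemma ge0_integral_subcube N m z (f : Rn R n -> \bar R) :
  measurable_fun setT f -> (forall x, 0 <= f x)%E ->
  (\int[mu]_(x in dyadic_cube N z) f x =
   \sum_w \int[mu]_(x in dyadic_cube (N + m) (subcube m z w)) f x)%E.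
Proof.
move=> mf f0; rewrite (@dyadic_cube_split R n N m z).
apply: ge0_integral_bigsetU => //.
- by move=> w; exact: measurable_dyadic_cube.
- exact: index_enum_uniq.
- exact: dyadic_cube_trivIset.
- exact: measurable_funTS.
Qed.

Variable g : Rn R n -> R.
Hypotheses (mg : measurable_fun setT g) (g_ge0 : forall x, 0 <= g x).
Hypothesis g_fin : (\int[mu]_x (g x)%:E < +oo)%E.

Let mgE : measurable_fun setT (EFin \o g). Proof. exact/measurable_EFinP. Qed.

Lemma integral_fin D : measurable D ->
  (\int[mu]_(x in D) (g x)%:E = (\int[mu]_(x in D) g x)%:E)%E.
Proof.
move=> mD; rewrite fineK// ge0_fin_numE; last first.
  by apply: integral_ge0 => x _; rewrite lee_fin.
apply: le_lt_trans g_fin; apply: ge0_subset_integral => // x _.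
by rewrite lee_fin.
Qed.

Lemma Rintegral_nneg D : 0 <= \int[mu]_(x in D) g x.
Proof. by apply: Rintegral_ge0 => x _; exact: g_ge0. Qed.

Lemma Rintegral_subcube N m z : \int[mu]_(x in dyadic_cube N z) g x =
   \sum_w \int[mu]_(x in dyadic_cube (N + m) (subcube m z w)) g x.
Proof.
apply: EFin_inj; rewrite -integral_fin; last exact: measurable_dyadic_cube.
rewrite (@ge0_integral_subcube N m z (EFin \o g))//.
rewrite -sumEFin; apply: eq_bigr => w _; apply: integral_fin.
exact: measurable_dyadic_cube.
Qed.

End cube_integrals.

Section maximal.
Variables (R : realType) (n : nat) (p : R) (phi : Rn R n -> R).
Hypothesis p_gt1 : 1 < p.
Hypotheses (mphi : measurable_fun setT phi) (phi_ge0 : forall x, 0 <= phi x).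
Local Notation mu := (@lebesgue R n).
Hypothesis phi_fin : (\int[mu]_x (phi x)%:E < +oo)%E.
Hypothesis phip_fin : (\int[mu]_x (phi x `^ p)%:E < +oo)%E.
Implicit Types (N m : nat) (z : 'I_n -> int) (x : Rn R n) (M : R).

Let p_gt0 : 0 < p. Proof. exact: lt_trans p_gt1. Qed.

Definition mean N z : R := \int[mu]_(u in dyadic_cube N z) phi u / vol R n N.
Definition pmass N z : R := \int[mu]_(u in dyadic_cube N z) (phi u `^ p).

Let mphip : measurable_fun setT (fun x => phi x `^ p).
Proof. by apply: (measurableT_comp (measurable_powR p)). Qed.

Lemma vol_mean N z : vol R n N * mean N z = \int[mu]_(u in dyadic_cube N z) phi u.
Proof. by rewrite mulrC divfK// gt_eqF// vol_gt0. Qed.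

Lemma mean_ge0 N z : 0 <= mean N z.
Proof. by rewrite divr_ge0 ?Rintegral_nneg// ltW// vol_gt0. Qed.

Lemma mean_split N z :
  vol R n N * mean N z = \sum_w vol R n N.+1 * mean N.+1 (subcube 1 z w).
Proof.
rewrite vol_mean (@Rintegral_subcube R n phi _ _ _ N 1)// addn1.
by apply: eq_bigr => w _; rewrite vol_mean.
Qed.

Lemma pmass_split N z : pmass N z = \sum_w pmass N.+1 (subcube 1 z w).
Proof.
rewrite /pmass (@Rintegral_subcube R n _ mphip _ phip_fin N 1) ?addn1//.
by move=> x; exact: powR_ge0.
Qed.

(** Young's inequality between [phi u] and the constant [a], the mean itself, is integrated over the
    cube; the terms in [a^p] then combine. *)
Lemma mean_jensen N z : vol R n N * mean N z `^ p <= pmass N z.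
Proof.
have mD := @measurable_dyadic_cube R n N z.
set a := mean N z; have a0 : 0 <= a by exact: mean_ge0.
suff : p * a `^ (p - 1) * (vol R n N * a) <= pmass N z + (p - 1) * a `^ p * vol R n N.
  have := powR_pred p_gt1 a0; set v := vol _ _ _ => e.
  have -> : p * a `^ (p - 1) * (v * a) = p * v * a `^ p by rewrite -e; ring.
  by lra.
rewrite /a vol_mean -/a -lee_fin EFinM EFinD.
rewrite -integral_fin// -(@integral_fin R n (fun u => phi u `^ p))//; last first.
  by move=> x; exact: powR_ge0.
have pa0 : 0 <= p * a `^ (p - 1) by rewrite mulr_ge0 ?powR_ge0 ?ltW.
have pa1 : 0 <= (p - 1) * a `^ p by rewrite mulr_ge0 ?powR_ge0// subr_ge0 ltW.
have mphiE : measurable_fun (dyadic_cube N z) (fun x => (phi x)%:E).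
  exact/measurable_funTS/measurable_EFinP.
have phi0 x : dyadic_cube N z x -> (0 <= (phi x)%:E)%E by rewrite lee_fin.
have pa0E : (0 <= (p * a `^ (p - 1))%:E)%E by rewrite lee_fin.
rewrite -(@ge0_integralZl _ _ _ mu _ mD _ mphiE _ phi0 pa0E).
rewrite [X in (_ + X)%E]EFinM -(lebesgue_dyadic_cube R N z) -integral_cst//.
have mphipE : measurable_fun (dyadic_cube N z) (fun x => (phi x `^ p)%:E).
  exact/measurable_funTS/measurable_EFinP.
have phip0 x : dyadic_cube N z x -> (0 <= (phi x `^ p)%:E)%E.
  by move=> _; rewrite lee_fin powR_ge0.
have c0 x : dyadic_cube N z x -> (0 <= cst ((p - 1) * a `^ p)%:E x)%E by [].
rewrite -(@ge0_integralD _ _ _ mu _ mD _ _ phip0 mphipE c0 (measurable_cst _)).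
apply: ge0_le_integral.
- exact: mD.
- by move=> x _; rewrite -EFinM lee_fin mulr_ge0.
- apply/measurable_funTS/measurable_EFinP.
  by apply: measurable_funM => //; exact: measurable_cst.
- apply/measurable_funTS/measurable_EFinP.
  by apply: measurable_funD => //; exact: measurable_cst.
move=> x _; rewrite -EFinM lee_fin.
have := young_powR p_gt1 (phi_ge0 x) a0.
by rewrite mulrCA [phi x * _]mulrC -!mulrA.
Qed.

Fixpoint running_max m N M x : R :=
  if m is m'.+1 then running_max m' N.+1 (Num.max M (mean N.+1 (gidx N.+1 x))) x
  else M.

Lemma measurable_running_max m N (M : Rn R n -> R) : measurable_fun setT M ->
  measurable_fun setT (fun x => running_max m N (M x) x).
Proof.
elim: m N M => [//|m IH] N M mM /=.
apply: (IH N.+1 (fun x => Num.max (M x) (mean N.+1 (gidx N.+1 x)))).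
apply: measurable_maxr; first exact: mM.
exact: (measurable_fun_gidx N.+1 (mean N.+1)).
Qed.

Lemma integral_running_max m N z M :
  (\int[mu]_(x in dyadic_cube N z) (running_max m N M x `^ p)%:E =
   (max_tree p mean m N z M)%:E)%E.
Proof.
elim: m N z M => [|m IH] N z M /=.
  rewrite integral_cst; last exact: measurable_dyadic_cube.
  by rewrite measure_dyadic_cube -EFinM mulrC.
rewrite (@ge0_integral_subcube _ _ N 1 z); last 2 first.
- apply/measurable_EFinP; apply: (measurableT_comp (measurable_powR p)).
  apply: (@measurable_running_max m N.+1 (fun x => Num.max M (mean N.+1 (gidx N.+1 x)))).
  apply: measurable_maxr; first exact: measurable_cst.
  exact: (measurable_fun_gidx N.+1 (mean N.+1)).
- by move=> x; rewrite lee_fin powR_ge0.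
rewrite -sumEFin addn1; apply: eq_bigr => w _; rewrite -IH.
(* On a child cube [gidx] is constant, so the updated maximum does not depend on [x]. *)
by apply: eq_integral => x /set_mem /dyadic_cubeE ->.
Qed.

Lemma running_max_ge m N M x : M <= running_max m N M x.
Proof.
elim: m N M => [|m IH] N M //=.
by apply: le_trans (IH N.+1 _); rewrite le_max lexx.
Qed.

Lemma running_max_homo N M x :
  {homo (fun m => running_max m N M x) : m m' / (m <= m')%N >-> m <= m'}.
Proof.
move=> m m'; elim: m m' N M => [|m IH] [|m'] N M//=.
  by move=> _; apply: le_trans (running_max_ge _ _ _ _); rewrite le_max lexx.
by rewrite ltnS; exact: IH.
Qed.

Lemma mean_running_max N M x j : mean (N + j.+1) (gidx (N + j.+1) x) <= running_max j.+1 N M x.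
Proof.
elim: j N M => [|j IH] N M.
  by rewrite addn1 /= le_max lexx orbT.
by rewrite -addSnnS; exact: IH.
Qed.

Lemma running_max_le (D : \bar R) m N M x : (M%:E <= D)%E ->
  (forall j, (N < j)%N -> ((mean j (gidx j x))%:E <= D)%E) ->
  ((running_max m N M x)%:E <= D)%E.
Proof.
elim: m N M => [//|m IH] N M MD h /=; apply: IH.
  by rewrite EFin_max ge_max MD h.
by move=> j Nj; apply: h; exact: ltnW.
Qed.

Lemma average_mean N z :
  average (dyadic_cube N z) (fun u => `|phi u|%:E) = (mean N z)%:E.
Proof.
rewrite /average lebesgue_dyadic_cube.
under eq_integral do rewrite ger0_norm//.
rewrite integral_fin//; last exact: measurable_dyadic_cube.
by rewrite inver gt_eqF ?vol_gt0// -EFinM mulrC.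
Qed.

Variables (N0 : nat) (z0 : 'I_n -> int).
Hypothesis phi_supp : forall x, ~ dyadic_cube N0 z0 x -> phi x = 0.
Local Notation Q := (@dyadic_cube R n N0 z0).
Local Notation f := (mean N0 z0).

(** A cube of generation at most [N0] that meets [Q] contains it; as [phi] vanishes off [Q], its
    average spreads the same integral over at least the same volume and cannot exceed [f]. So the
    supremum may start from [f] and run over finer generations. *)
Lemma dyadic_maximalE x : Q x ->
  dyadic_maximal phi x = ereal_sup (range (fun m => (running_max m N0 f x)%:E)).
Proof.
move=> Qx; apply/eqP; rewrite eq_le; apply/andP; split; last first.
  apply: ge_ereal_sup => _ [m _ <-].
  have h j : ((mean j (gidx j x))%:E <= dyadic_maximal phi x)%E.
    rewrite -average_mean; apply: ereal_sup_ubound; exists (dyadic_cube j (gidx j x)) => //.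
    by split; [by exists j, (gidx j x) | exact: dyadic_cube_gidx].
  apply: running_max_le => //.
  by have /dyadic_cubeE <- := Qx; exact: h.
apply: ge_ereal_sup => _ [P [[N [z ->]] Px] <-]; rewrite average_mean.
have [NN0|NN0] := leqP N N0; last first.
  apply: (@le_trans _ _ (running_max (N - N0) N0 f x)%:E); last first.
    by apply: ereal_sup_ubound; exists (N - N0)%N.
  have /dyadic_cubeE <- := Px; rewrite lee_fin.
  case: (N - N0)%N (subnKC (ltnW NN0)) => [|j <-].
    by rewrite addn0 => E; rewrite E ltnn in NN0.
  exact: mean_running_max.
apply: (@le_trans _ _ f%:E); last by apply: ereal_sup_ubound; exists 0%N.
rewrite lee_fin /= ler_pdivrMr ?vol_gt0//.
apply: (@le_trans _ _ (vol R n N0 * f)); last first.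
  rewrite mulrC ler_wpM2l ?mean_ge0//.
  rewrite -(subnKC NN0) volD ler_piMr ?vol_le1//.
  exact/ltW/vol_gt0.
rewrite vol_mean -lee_fin -!integral_fin//; try exact: measurable_dyadic_cube.
rewrite [leLHS](_ : _ = (\int[mu]_(x in Q) (phi x)%:E)%E)//.
rewrite [RHS]integral_mkcond [LHS]integral_mkcond; apply: eq_integral => y _.
rewrite /patch; case: ifPn => [_|/negP zy]; case: ifPn => [Qy|/negP Qy] //.
  by rewrite phi_supp// => /mem_set.
exfalso; apply: zy; apply/mem_set.
by apply: (dyadic_cube_nested NN0 Px Qx); exact: (set_mem Qy).
Qed.

Lemma cvg_running_max_powR x : Q x ->
  (running_max m N0 f x `^ p)%:E @[m --> \oo] --> (dyadic_maximal phi x `^ p)%E.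
Proof.
move=> Qx.
have f0 : 0 <= f by exact: mean_ge0.
have -> : (dyadic_maximal phi x `^ p)%E =
    ereal_sup (range (fun m => (running_max m N0 f x `^ p)%:E)).
  rewrite dyadic_maximalE// -ereal_sup_poweR//.
  - congr ereal_sup; apply/seteqP; split => [_ [_ [m _ <-] <-]|_ [m _ <-]].
      by exists m.
    by exists (running_max m N0 f x)%:E => //; exists m.
  - by exists (running_max 0 N0 f x)%:E; exists 0%N.
  - by move=> _ [m _ <-]; rewrite lee_fin; apply: le_trans f0 (running_max_ge _ _ _ _).
apply: ereal_nondecreasing_cvgn => m m' mm'; rewrite lee_fin.
apply: ge0_ler_powR; rewrite ?nnegrE ?(ltW p_gt0)//.
- exact: le_trans f0 (running_max_ge _ _ _ _).
- exact: le_trans f0 (running_max_ge _ _ _ _).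
- exact: running_max_homo.
Qed.

Let measurable_running_max_powR m :
  measurable_fun Q (fun x => (running_max m N0 f x `^ p)%:E).
Proof.
apply/measurable_funTS/measurable_EFinP; apply: (measurableT_comp (measurable_powR p)).
by apply: (@measurable_running_max m N0 (cst f)); exact: measurable_cst.
Qed.

Lemma measurable_dyadic_maximal_powR :
  measurable_fun Q (fun x => (dyadic_maximal phi x `^ p)%E).
Proof.
apply: (emeasurable_fun_cvg (fun m x => (running_max m N0 f x `^ p)%:E)) => //.
exact: cvg_running_max_powR.
Qed.

Lemma cvg_max_tree :
  (max_tree p mean m N0 z0 f)%:E @[m --> \oo] -->
  (\int[mu]_(x in Q) (dyadic_maximal phi x `^ p))%E.
Proof.
have -> : (fun m => (max_tree p mean m N0 z0 f)%:E) =
    (fun m => \int[mu]_(x in Q) (running_max m N0 f x `^ p)%:E)%E.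
  by apply/funext => m; rewrite integral_running_max.
have -> : (\int[mu]_(x in Q) (dyadic_maximal phi x `^ p) = \int[mu]_(x in Q)
    limn (fun m => (running_max m N0 f x `^ p)%:E))%E.
  apply: eq_integral => x /set_mem Qx; apply/esym/cvg_lim => //.
  exact: cvg_running_max_powR.
apply: cvg_monotone_convergence => //.
- exact: measurable_dyadic_cube.
- by move=> m x _; rewrite lee_fin powR_ge0.
- move=> x _ m m' mm'; rewrite lee_fin.
  have f0 : 0 <= f by exact: mean_ge0.
  apply: ge0_ler_powR; rewrite ?nnegrE ?(ltW p_gt0)//.
  + exact: le_trans f0 (running_max_ge _ _ _ _).
  + exact: le_trans f0 (running_max_ge _ _ _ _).
  + exact: running_max_homo.
Qed.

End maximal.


(** * The estimate for a single admissible function *)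

Section admissible.
Variables (R : realType) (n : nat) (p f F : R) (N0 : nat) (z0 : 'I_n -> int).
Hypothesis p_gt1 : 1 < p.
Local Notation mu := (@lebesgue R n).
Local Notation Q := (@dyadic_cube R n N0 z0).
Local Notation v0 := (vol R n N0).

Let p_gt0 : 0 < p. Proof. exact: lt_trans p_gt1. Qed.

Lemma average_dyadic_cube N z (g : Rn R n -> \bar R) :
  average (dyadic_cube N z) g =
  ((vol R n N)^-1%:E * \int[mu]_(u in dyadic_cube N z) g u)%E.
Proof. by rewrite /average lebesgue_dyadic_cube inver gt_eqF ?vol_gt0. Qed.

Lemma average_eqP N z (g : Rn R n -> \bar R) (a : R) :
  average (dyadic_cube N z) g = a%:E <->
  (\int[mu]_(u in dyadic_cube N z) g u = (vol R n N * a)%:E)%E.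
Proof.
have v0 := vol_gt0 R n N; rewrite average_dyadic_cube; split=> [h|->].
  rewrite EFinM -h muleA -EFinM divff ?gt_eqF//.
  by rewrite mul1e.
by rewrite -EFinM mulKf ?gt_eqF.
Qed.

Lemma integral_supp (g : Rn R n -> R) : (forall x, ~ Q x -> g x = 0) ->
  (\int[mu]_x (g x)%:E = \int[mu]_(x in Q) (g x)%:E)%E.
Proof.
move=> gQ; rewrite [RHS]integral_mkcond; apply: eq_integral => x _.
by rewrite /patch; case: ifPn => // /negP Qx; rewrite gQ// => /mem_set.
Qed.

Variable phi : Rn R n -> R.
Hypothesis adm : admissible p Q f F phi.

Lemma admissible_meas : measurable_fun setT phi. Proof. by case: adm. Qed.
Lemma admissible_ge0 x : 0 <= phi x. Proof. by case: adm. Qed.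
Lemma admissible_supp x : ~ Q x -> phi x = 0. Proof. by case: adm => _ _ + _ _; exact. Qed.
Lemma admissible_int : (\int[mu]_(x in Q) (phi x)%:E = (v0 * f)%:E)%E.
Proof. by case: adm => _ _ _ /average_eqP. Qed.
Lemma admissible_intp : (\int[mu]_(x in Q) (phi x `^ p)%:E = (v0 * F)%:E)%E.
Proof. by case: adm => _ _ _ _ /average_eqP. Qed.

Lemma admissible_fin : (\int[mu]_x (phi x)%:E < +oo)%E.
Proof. by rewrite integral_supp ?admissible_int ?ltry//; exact: admissible_supp. Qed.

Lemma admissible_finp : (\int[mu]_x (phi x `^ p)%:E < +oo)%E.
Proof.
rewrite integral_supp ?admissible_intp ?ltry// => x Qx.
by rewrite admissible_supp// powR0// gt_eqF.
Qed.

Lemma admissible_mean : mean phi N0 z0 = f.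
Proof. by rewrite /mean /Rintegral admissible_int/= mulrC mulKf// gt_eqF// vol_gt0. Qed.

Lemma admissible_pmass : pmass p phi N0 z0 = v0 * F.
Proof. by rewrite /pmass /Rintegral admissible_intp. Qed.

Lemma admissible_f_ge0 : 0 <= f.
Proof.
rewrite -admissible_mean; apply: mean_ge0; exact: admissible_ge0.
Qed.

Variable om : R.
Hypotheses (om_ge1 : 1 <= om)
  (fF : f `^ p = F * (p * om `^ (p - 1) - (p - 1) * om `^ p)).

Let om_gt0 : 0 < om. Proof. exact: lt_le_trans om_ge1. Qed.

(** If the average reached [be], the loss [d] on that subcube would lower the bound on the maximal
    average by more than the permitted deficit [eta]. The lower bound is asked only for [om > 1]:
    when [om = 1] the factor [c] vanishes and [key] already reads [d <= 0]. *)
Lemma mean_lt (al be eta : R) ws :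
  f <= al -> al < be -> (0 < size ws)%N ->
  (forall i, (0 < i < size ws)%N -> mean phi (N0 + i) (descend z0 (take i ws)) <= al) ->
  (1 < om -> ((F * om `^ p - eta)%:E <= maximal_average p Q phi)%E) ->
  (p - 1) * (1 - om^-1) * (v0 * eta) < vol R n (N0 + size ws) * gap p al be ->
  mean phi (N0 + size ws) (descend z0 ws) < be.
Proof.
move=> fal albe sz proper lb etab; rewrite ltNge; apply/negP => be_le.
have f0 := admissible_f_ge0.
set c := (p - 1) * (1 - om^-1) in etab *.
have c0 : 0 <= c by apply: mulr_ge0; rewrite subr_ge0; [exact: ltW|rewrite invf_le1].
set d := vol R n (N0 + size ws) * gap p al be in etab *.
have key m : (size ws <= m)%N ->
    c * max_tree p (mean phi) m N0 z0 f + d <= c * (v0 * (F * om `^ p)).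
  move=> szm.
  have := @max_tree_gap R p n (mean phi) (pmass p phi) p_gt1.
  move=> /(_ (mean_ge0 admissible_ge0)).
  move=> /(_ (mean_split admissible_meas admissible_ge0 admissible_fin)).
  move=> /(_ (pmass_split admissible_meas admissible_finp)).
  move=> /(_ (mean_jensen p_gt1 admissible_meas admissible_ge0 admissible_fin admissible_finp)).
  move=> /(_ om al be m N0 z0 f ws om_ge1 f0 fal (ltW albe)).
  rewrite sz szm => /(_ isT proper be_le) h.
  apply: le_trans h _.
  (* The potential starts at [- f^p], and the equation for [om] turns [om^(p-1) F - f^p] into
     [(p-1) (1 - 1/om) F om^p]. *)
  rewrite admissible_mean admissible_pmass potential_diag// fF.
  rewrite le_eqVlt; apply/orP; left; apply/eqP.
  rewrite /c -(powR_pred p_gt1 (ltW om_gt0)).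
  by field; rewrite gt_eqF.
have d0 : 0 < d by rewrite mulr_gt0 ?vol_gt0// gap_gt0// (le_trans f0).
have [c_gt0|c_le0] := ltP 0 c; last first.
  have c_eq0 : c = 0 by apply/eqP; rewrite eq_le c_le0.
  by have := key _ (leqnn _); rewrite c_eq0 !mul0r add0r leNgt d0.
have ub : (maximal_average p Q phi <= (v0^-1 * (v0 * (F * om `^ p) - d / c))%:E)%E.
  rewrite /maximal_average average_dyadic_cube EFinM lee_wpmul2l//.
    by rewrite lee_fin invr_ge0 ltW// vol_gt0.
  have := @cvg_max_tree R n p phi p_gt1 admissible_meas admissible_ge0
    admissible_fin N0 z0 admissible_supp.
  rewrite admissible_mean => cv.
  rewrite -(cvg_lim _ cv)//; apply: lime_le; first by apply/cvg_ex; eexists; exact: cv.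
  exists (size ws) => // m /= szm; rewrite lee_fin lerBrDr -(ler_pM2l c_gt0) mulrDr.
  rewrite (mulrC c (d / c)) divfK ?gt_eqF//; exact: key.
have om1 : 1 < om.
  rewrite lt_neqAle om_ge1 andbT eq_sym; apply/eqP => om1.
  by move: c_gt0; rewrite /c om1 invr1 subrr mulr0 ltxx.
have := le_trans (lb om1) ub; rewrite lee_fin mulrBr mulKf ?gt_eqF ?vol_gt0//.
rewrite lerD2l lerN2 -(ler_pM2l (vol_gt0 R n N0)) mulrA divff ?gt_eqF ?vol_gt0// mul1r.
rewrite ler_pdivrMr// mulrC leNgt => /negP; apply.
exact: etab.
Qed.

End admissible.

(** * Averages along extremal sequences *)

Section means_converge.
Variables (R : realType) (n : nat) (p f F om : R) (N0 : nat) (z0 : 'I_n -> int).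
Hypothesis p_gt1 : 1 < p.
Local Notation Q := (@dyadic_cube R n N0 z0).
Variable phi : nat -> Rn R n -> R.
Hypothesis adm : forall k, admissible p Q f F (phi k).
Hypotheses (om_ge1 : 1 <= om)
  (fF : f `^ p = F * (p * om `^ (p - 1) - (p - 1) * om `^ p)).
Hypothesis near_max : forall eta : R, 0 < eta -> \forall k \near \oo,
  (1 < om -> ((F * om `^ p - eta)%:E <= maximal_average p Q (phi k))%E).
Local Notation J ws := (fun k => mean (phi k) (N0 + size ws) (descend z0 ws)).

Let f_ge0 : 0 <= f. Proof. exact: (admissible_f_ge0 (adm 0)). Qed.

(** The finitely many proper ancestors have averages tending to [f], hence eventually at most [al],
    halfway to [f + e]; [mean_lt] then applies with [be = f + e]. *)
Lemma limsup_mean (ws : seq {ffun 'I_n -> 'I_(2 ^ 1)}) (e : R) : 0 < e ->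
  (forall i, (i < size ws)%N -> J (take i ws) k @[k --> \oo] --> f) ->
  \forall k \near \oo, J ws k < f + e.
Proof.
move=> e0 IH; have [ws0|sz] := posnP (size ws).
  rewrite (size0nil ws0); apply: nearW => k /=.
  by rewrite addn0 (admissible_mean (adm k)) ltrDl.
pose al := f + e / 2; have fal : f <= al by rewrite lerDl divr_ge0// ltW.
have albe : al < f + e by rewrite ltrD2l gtr_pMr// invf_lt1// ltr1n.
pose d := vol R n (N0 + size ws) * gap p al (f + e).
have d0 : 0 < d by rewrite mulr_gt0 ?vol_gt0// gap_gt0// (le_trans f_ge0).
pose c := (p - 1) * (1 - om^-1) * vol R n N0.
have c0 : 0 <= c.
  apply: mulr_ge0; last exact/ltW/vol_gt0.
  apply: mulr_ge0; rewrite subr_ge0; [exact: ltW|rewrite invf_le1//].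
  exact: lt_le_trans om_ge1.
(* This gives [c * eta < d]; the denominator is [c + 1] because [c = 0] when [om = 1]. *)
pose eta := d / (c + 1).
have c1 : 0 < c + 1 by rewrite ltr_wpDl.
have eta0 : 0 < eta by rewrite divr_gt0.
have proper : \forall k \near \oo, forall i : 'I_(size ws), J (take i ws) k <= al.
  apply: filter_forall => i.
  have /cvgrPdist_lt /(_ (e / 2)) := IH i (ltn_ord i).
  rewrite divr_gt0// => /(_ isT); apply: filterS => k /=.
  rewrite /al ltr_norml => /andP[h _]; rewrite ltrBrDr in h; move: h.
  by set x := mean _ _ _; lra.
near=> k.
apply: (@mean_lt R n p f F N0 z0 p_gt1 (phi k) (adm k) om om_ge1 fF al _ eta) => //.
- move=> i /andP[_ iw]; have : forall i : 'I_(size ws), J (take i ws) k <= al by near: k.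
  by move=> /(_ (Ordinal iw)) /=; rewrite size_takel// ltnW.
- by near: k; exact: near_max.
- rewrite mulrA -/c -/d /eta mulrCA gtr_pMr//.
  by rewrite ltr_pdivrMr// mul1r ltrDl.
Unshelve. all: by end_near. Qed.

Lemma cvg_mean (ws : seq {ffun 'I_n -> 'I_(2 ^ 1)}) : J ws k @[k --> \oo] --> f.
Proof.
have [m] := ubnP (size ws); elim: m ws => // m IH ws.
have [->|[w0 [ws' ->]]] : ws = [::] \/ exists w ws', ws = rcons ws' w.
- by case/lastP: ws => [|ws' w]; [left|right; exists w, ws'].
- move=> _; apply: cvg_near_cst; apply: nearW => k /=.
  by rewrite addn0 (admissible_mean (adm k)).
rewrite size_rcons ltnS => szm.
have IH' w i : (i < size (rcons ws' w))%N -> J (take i (rcons ws' w)) k @[k --> \oo] --> f.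
  rewrite size_rcons ltnS => iw; apply: IH.
  by rewrite size_takel ?size_rcons ?(leq_trans iw)// (leq_ltn_trans iw).
pose B : R := #|{ffun 'I_n -> 'I_(2 ^ 1)}|%:R.
have B_gt0 : 0 < B.
  by rewrite ltr0n; apply/card_gt0P; exists w0.
(* Siblings have equal volume, so their deviations from [f] add up to [B] times that of the
   parent. *)
have parent k : B * (J ws' k - f) = \sum_w (J (rcons ws' w) k - f).
  have v1 : 0 < vol R n (N0 + size ws').+1 by exact: vol_gt0.
  apply: (mulfI (lt0r_neq0 v1)).
  rewrite mulr_sumr.
  under eq_bigr do rewrite mulrBr size_rcons addnS /descend foldl_rcons.
  rewrite sumrB -(mean_split (admissible_meas (adm k)) (admissible_ge0 (adm k))
    (admissible_fin (adm k))).
  have -> : vol R n (N0 + size ws') = vol R n (N0 + size ws').+1 * B.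
    by rewrite vol_split sumr_const -mulr_natr.
  rewrite -/(descend z0 ws') sumr_const -mulr_natl -/B.
  by set a := mean _ _ _; set v := vol _ _ _; ring.
apply/cvgrPdist_lt => e e0.
(* A single deviation is the total, above [- B * d], minus the others, together at most [B * d];
   this leaves more than [- e]. *)
pose d := e / (2 * B).
have d0 : 0 < d by rewrite divr_gt0// mulr_gt0.
have de : B * d = e / 2 by rewrite /d; field; rewrite gt_eqF.
have up : \forall k \near \oo, forall w, J (rcons ws' w) k < f + d.
  by apply: filter_forall => w; apply: limsup_mean => //; exact: IH'.
have /cvgrPdist_lt /(_ d d0) low : J ws' k @[k --> \oo] --> f by exact: IH.
near=> k.
have upk : forall w, J (rcons ws' w) k < f + d by near: k.
have : `|f - J ws' k| < d by near: k.
rewrite ltr_norml => /andP[_ lk].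
have dB : d <= B * d by rewrite ler_peMl ?(ltW d0)// ler1n -(ltr0n R).
have := parent k; rewrite (bigD1 w0)//= => pk.
have rest : \sum_(i | i != w0) (J (rcons ws' i) k - f) <= B * d.
  apply: (@le_trans _ _ (\sum_(i : {ffun 'I_n -> 'I_(2 ^ 1)} | i != w0) d)).
    by apply: ler_sum => w _; rewrite lerBlDl ltW.
  apply: (@le_trans _ _ (\sum_(i : {ffun 'I_n -> 'I_(2 ^ 1)}) d)).
    by rewrite [leRHS](bigD1 w0)//= lerDr (ltW d0).
  by rewrite sumr_const -mulr_natl.
have lB : B * (f - J ws' k) < B * d by rewrite ltr_pM2l.
have := upk w0; rewrite /= in pk rest lB *.
rewrite ltr_norml -(size_rcons ws' w0); move: pk rest lB dB de.
set x := mean _ _ (descend z0 (rcons _ _)); set y := mean _ _ _; set S := \sum_(_ | _) _.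
move=> pk rest lB dB de xd; apply/andP; split; lra.
Unshelve. all: by end_near. Qed.

End means_converge.


(** * Weak convergence *)

Lemma cvg_norm_powR0 (R : realType) (q : R) (u : nat -> R) : 0 < q ->
  u m @[m --> \oo] --> 0 -> `|u m| `^ q @[m --> \oo] --> 0.
Proof.
move=> q0 /cvgrPdist_lt u0; apply/cvgrPdist_lt => e e0.
have := u0 (e `^ q^-1); rewrite powR_gt0// => /(_ isT).
apply: filterS => m; rewrite !sub0r !normrN => um.
rewrite (ger0_norm (powR_ge0 _ _)) -[ltRHS]powRr1 ?(ltW e0)//.
rewrite -(@mulVf _ q) ?gt_eqF// powRrM.
by apply: gt0_ltr_powR; rewrite ?nnegrE ?powR_ge0.
Qed.

Section weak_convergence.
Context d (T : measurableType d) (R : realType).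
Variables (mu : {measure set T -> \bar R}) (D : set T) (mD : measurable D).
Variables (p q : R).
Hypotheses (p_gt0 : 0 < p) (q_gt0 : 0 < q) (pq : p^-1 + q^-1 = 1).
Implicit Types h : T -> R.

(** Measurability of [h] is recorded separately because it does not follow from that of [|h|^r]. *)
Definition powR_integrable (r : R) h :=
  measurable_fun D h /\ mu.-integrable D (fun x => (`|h x| `^ r)%:E).

Lemma measurable_powR_norm r h : measurable_fun D h ->
  measurable_fun D (fun x => `|h x| `^ r).
Proof.
move=> mh; apply: (measurableT_comp (measurable_powR r)).
by apply: (measurableT_comp (@normr_measurable R setT)).
Qed.

Lemma powR_integrable_le (r : R) h h' : 0 <= r -> measurable_fun D h ->
  (forall x, D x -> `|h x| <= `|h' x|) -> powR_integrable r h' -> powR_integrable r h.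
Proof.
move=> r0 mh hh' [mh' ih']; split=> //.
apply: (le_integrable mD _ _ ih').
  exact/measurable_EFinP/measurable_powR_norm.
move=> x Dx; rewrite !gee0_abs ?lee_fin ?powR_ge0//.
by apply: ge0_ler_powR; rewrite ?nnegrE//; exact: hh'.
Qed.

Lemma powR_integrableZ (r : R) h c : 0 <= r ->
  powR_integrable r h -> powR_integrable r (fun x => c * h x).
Proof.
move=> r0 [mh ih]; split; first by apply: measurable_funM => //; exact: measurable_cst.
have := integrableZl mD (`|c| `^ r) ih; apply: eq_integrable => // x _ /=.
by rewrite normrM powRM// EFinM.
Qed.

(** [|h - h'|] is at most twice the larger of [|h|] and [|h'|], so [|2 h|^r + |2 h'|^r]
    dominates. *)
Lemma powR_integrableB (r : R) h h' : 0 <= r ->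
  powR_integrable r h -> powR_integrable r h' -> powR_integrable r (fun x => h x - h' x).
Proof.
move=> r0 ih ih'; have [mh2 ih2] := powR_integrableZ 2 r0 ih.
have [mh2' ih2'] := powR_integrableZ 2 r0 ih'.
case: ih ih' => mh _ [mh' _].
have mB : measurable_fun D (fun x => h x - h' x) by exact: measurable_funB.
split=> //; apply: (le_integrable mD _ _ (integrableD mD ih2 ih2')).
  exact/measurable_EFinP/measurable_powR_norm.
move=> x Dx; rewrite gee0_abs; last by rewrite lee_fin powR_ge0.
rewrite gee0_abs; last by rewrite adde_ge0// lee_fin powR_ge0.
rewrite -[leRHS]/((`|2 * h x| `^ r + `|2 * h' x| `^ r)%:E) lee_fin.
have := ler_normB (h x) (h' x).
have /orP[hh'|hh'] := le_total `|h x| `|h' x| => nB.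
  apply: ler_wpDl; first exact: powR_ge0.
  apply: ge0_ler_powR; rewrite ?nnegrE//; apply: le_trans nB _.
  by rewrite normrM ger0_norm// mulr2n mulrDl mul1r lerD2r.
apply: ler_wpDr; first exact: powR_ge0.
apply: ge0_ler_powR; rewrite ?nnegrE//; apply: le_trans nB _.
by rewrite normrM ger0_norm// mulr2n mulrDl mul1r lerD2l.
Qed.

Lemma powR_integrable0 r : 0 < r -> powR_integrable r (fun=> 0).
Proof.
move=> r0; split; first exact: measurable_cst.
apply: (eq_integrable mD (cst 0%E)); last exact: integrable0.
by move=> x _; rewrite /= normr0 powR0// gt_eqF.
Qed.

Lemma powR_integrableD (r : R) h h' : 0 < r ->
  powR_integrable r h -> powR_integrable r h' -> powR_integrable r (fun x => h x + h' x).
Proof.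
move=> r0 ih ih'.
have := powR_integrableB (ltW r0) ih
  (powR_integrableB (ltW r0) (powR_integrable0 r0) ih').
by under [X in powR_integrable _ X]eq_fun do rewrite sub0r opprK.
Qed.

Variables (psi : nat -> T -> R) (K : R).
Hypothesis ipsi : forall k, powR_integrable p (psi k).
Hypothesis psiK : forall k, \int[mu]_(x in D) (`|psi k x| `^ p) <= K.

Definition weak_null h := \int[mu]_(x in D) (psi k x * h x) @[k --> \oo] --> 0.

(** Young's inequality for [t * a] and [b / t]. A small [t] makes the coefficient of the [L^p] term
    small, which lets this play the part of Hölder's inequality. *)
Lemma young_scaled (t a b : R) : 0 < t -> 0 <= a -> 0 <= b ->
  a * b <= t `^ p / p * a `^ p + t^-1 `^ q / q * b `^ q.
Proof.
move=> t0 a0 b0.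
have := @conjugate_powR R (t * a) (t^-1 * b) p q.
rewrite !mulr_ge0 ?invr_ge0 ?(ltW t0)// => /(_ isT isT p_gt0 q_gt0 pq).
rewrite mulrACA divff ?gt_eqF// mul1r !powRM ?invr_ge0 ?(ltW t0)//.
by rewrite [X in _ <= X + _]mulrAC [X in _ <= _ + X]mulrAC.
Qed.

Lemma weak_integrable k h : powR_integrable q h ->
  mu.-integrable D (fun x => (psi k x * h x)%:E).
Proof.
move=> [mh ih]; have [mpsi ip] := ipsi k.
apply: (le_integrable mD _ _ (integrableD mD (integrableZl mD (1 `^ p / p) ip)
  (integrableZl mD (1^-1 `^ q / q) ih))).
  by apply/measurable_EFinP; exact: measurable_funM.
move=> x Dx; rewrite -[leRHS]/(`|1 `^ p / p * `|psi k x| `^ p +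
  1^-1 `^ q / q * `|h x| `^ q|%:E) -[leLHS]/(`|psi k x * h x|%:E) lee_fin.
rewrite [X in _ <= X]ger0_norm; last first.
  by rewrite addr_ge0// mulr_ge0 ?powR_ge0// divr_ge0 ?powR_ge0// ltW.
by rewrite normrM; apply: young_scaled.
Qed.

Lemma weak_bound k h (t : R) : 0 < t -> powR_integrable q h ->
  `|\int[mu]_(x in D) (psi k x * h x)| <=
    t `^ p / p * K + t^-1 `^ q / q * \int[mu]_(x in D) (`|h x| `^ q).
Proof.
move=> t0 ih; have wi := weak_integrable k ih.
apply: le_trans (le_normr_Rintegral mD wi) _.
case: ih => mh ih; have [mpsi ip] := ipsi k.
have ip' := integrableZl mD (t `^ p / p) ip.
have ih' := integrableZl mD (t^-1 `^ q / q) ih.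
apply: (@le_trans _ _ (\int[mu]_(x in D)
    (t `^ p / p * `|psi k x| `^ p + t^-1 `^ q / q * `|h x| `^ q))).
  apply: le_Rintegral => //.
  - by have := integrable_norm wi.
  - exact: (integrableD mD ip' ih').
  - by move=> x Dx; rewrite normrM; apply: young_scaled.
rewrite RintegralD// !RintegralZl// lerD2r ler_wpM2l//.
by rewrite divr_ge0 ?powR_ge0// ltW.
Qed.

Lemma weak_nullB h h' : powR_integrable q h -> powR_integrable q h' ->
  weak_null h -> weak_null h' -> weak_null (fun x => h x - h' x).
Proof.
move=> ih ih' wh wh'; rewrite /weak_null.
have -> : (fun k => \int[mu]_(x in D) (psi k x * (h x - h' x))) =
   (fun k => \int[mu]_(x in D) (psi k x * h x) - \int[mu]_(x in D) (psi k x * h' x)).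
  apply/funext => k; rewrite -RintegralB//; try exact: weak_integrable.
  by apply: eq_Rintegral => x _; rewrite mulrBr.
by rewrite -(subr0 0); exact: cvgB.
Qed.

Lemma weak_null0 : weak_null (fun=> 0).
Proof.
rewrite /weak_null; under eq_fun do under eq_Rintegral do rewrite mulr0.
by under eq_fun do rewrite Rintegral_cst// mul0r; exact: cvg_cst.
Qed.

Lemma weak_nullD h h' : powR_integrable q h -> powR_integrable q h' ->
  weak_null h -> weak_null h' -> weak_null (fun x => h x + h' x).
Proof.
move=> ih ih' wh wh'.
have i0 := powR_integrable0 q_gt0.
have := weak_nullB ih (powR_integrableB (ltW q_gt0) i0 ih') wh (weak_nullB i0 ih' weak_null0 wh').
by under [X in weak_null X]eq_fun do rewrite sub0r opprK.
Qed.

Lemma weak_nullZ c h : powR_integrable q h -> weak_null h -> weak_null (fun x => c * h x).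
Proof.
move=> ih wh; rewrite /weak_null.
have -> : (fun k => \int[mu]_(x in D) (psi k x * (c * h x))) =
   (fun k => c * \int[mu]_(x in D) (psi k x * h x)).
  apply/funext => k; rewrite -RintegralZl//; last exact: weak_integrable.
  by apply: eq_Rintegral => x _; rewrite mulrCA.
by rewrite -(mulr0 c); apply: cvgMr.
Qed.

Lemma weak_null_closed h : powR_integrable q h ->
  (forall e : R, 0 < e -> exists h', [/\ powR_integrable q h', weak_null h' &
     \int[mu]_(x in D) (`|h x - h' x| `^ q) <= e]) -> weak_null h.
Proof.
move=> ih approx; apply/cvgrPdist_lt => e e0.
have K0 : 0 <= K.
  by apply: le_trans (psiK 0); apply: Rintegral_ge0 => x _; exact: powR_ge0.
(* [s] will be [t^p], chosen so that the [L^p] term [s / p * K] is at most [e / 3]; the denominator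
   is [K + 1] because [K] may be [0]. *)
pose s := e / 3 * (p / (K + 1)).
have K1 : 0 < K + 1 by rewrite ltr_wpDl.
have s0 : 0 < s by rewrite mulr_gt0 ?divr_gt0.
pose t := s `^ p^-1; have t0 : 0 < t by rewrite powR_gt0.
have tp : t `^ p = s by rewrite /t -powRrM mulVf ?gt_eqF// powRr1// ltW.
pose c := t^-1 `^ q / q; have c0 : 0 < c by rewrite divr_gt0 ?powR_gt0 ?invr_gt0.
have e3 : 0 < e / 3 by rewrite divr_gt0.
(* The accuracy [e / 3 / c] makes the [L^q] term of [weak_bound] at most [e / 3] as well. *)
have [h' [ih' wh' hh']] := approx _ (divr_gt0 e3 c0).
move/cvgrPdist_lt : wh' => /(_ _ e3).
apply: filterS => k; rewrite !sub0r !normrN => wk.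
have iB := powR_integrableB (ltW q_gt0) ih ih'.
have -> : \int[mu]_(x in D) (psi k x * h x) =
    \int[mu]_(x in D) (psi k x * (h x - h' x)) + \int[mu]_(x in D) (psi k x * h' x).
  rewrite -RintegralD//; try exact: weak_integrable.
  by apply: eq_Rintegral => x _; rewrite -mulrDr subrK.
apply: le_lt_trans (ler_normD _ _) _.
have := weak_bound k t0 iB; rewrite tp -/c.
have sK : s / p * K <= e / 3.
  have -> : s / p * K = e / 3 * (K / (K + 1)) by rewrite /s; field; rewrite !gt_eqF.
  by rewrite ler_piMr ?(ltW e3)// ler_pdivrMr// mul1r lerDl.
have := hh'; rewrite ler_pdivlMr// mulrC.
set I1 := Rintegral _ _ _; set I2 := Rintegral _ _ _; set I3 := Rintegral _ _ _ in wk *.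
by move: wk sK; set z := s / p * K; lra.
Qed.

Lemma weak_null_dominated h (h_ : nat -> T -> R) g :
  powR_integrable q h -> powR_integrable q g ->
  (forall m, powR_integrable q (h_ m)) -> (forall m, weak_null (h_ m)) ->
  (forall x, D x -> h_ m x @[m --> \oo] --> h x) ->
  (forall m x, D x -> `|h x - h_ m x| <= `|g x|) -> weak_null h.
Proof.
move=> ih ig ih_ wh_ h_h h_g; apply: weak_null_closed => // e e0.
have iB m := powR_integrableB (ltW q_gt0) ih (ih_ m).
have cv0 : (\int[mu]_(x in D) (`|h x - h_ m x| `^ q)%:E)%E @[m --> \oo] -->
    (\int[mu]_(x in D) (cst 0 x))%E.
  apply: (@dominated_cvg _ _ _ mu D mD _ _ (fun x => (`|g x| `^ q)%:E)) => //.
  - by move=> m; apply/measurable_EFinP/measurable_powR_norm; case: (iB m).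
  - move=> x Dx; apply: cvg_EFin; first exact: nearW.
    apply: cvg_norm_powR0 => //; rewrite -(subrr (h x)).
    by apply: cvgB; [exact: cvg_cst|exact: h_h].
  - by case: ig.
  - move=> m x Dx; rewrite gee0_abs ?lee_fin ?powR_ge0//.
    by apply: ge0_ler_powR; rewrite ?nnegrE ?(ltW q_gt0)//; exact: h_g.
rewrite integral0 in cv0.
move/fine_cvgP : cv0 => [_ /cvgrPdist_lt /(_ e e0)] [m _ /(_ m (leqnn _))] /=.
rewrite sub0r normrN => hm; exists (h_ m); split => //.
by apply/ltW; apply: le_lt_trans hm; rewrite ler_norm.
Qed.

Lemma powR_integrable_cst r c : (mu D < +oo)%E -> powR_integrable r (fun=> c).
Proof.
move=> muD; split; first exact: measurable_cst.
apply/integrableP; split; first exact: measurable_cst.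
have -> : (fun x : T => `|(`|c| `^ r)%:E|%E) = cst (`|c| `^ r)%:E.
  by apply/funext => x; rewrite gee0_abs// lee_fin powR_ge0.
by rewrite integral_cst// lte_mul_pinfty// lee_fin powR_ge0.
Qed.

Lemma powR_integrable_indic r A : 0 <= r -> (mu D < +oo)%E -> measurable A ->
  powR_integrable r (\1_A : T -> R).
Proof.
move=> r0 muD mA; apply: powR_integrable_le (powR_integrable_cst r 1 muD) => //.
by move=> x _; rewrite indicE normr1; case: (_ \in _); rewrite ?normr1 ?normr0.
Qed.

Definition weakly_nulled h := powR_integrable q h /\ weak_null h.

Lemma weakly_nulled_sum I (r : seq I) (F : I -> T -> R) :
  (forall i, weakly_nulled (F i)) -> weakly_nulled (fun x => \sum_(i <- r) F i x).
Proof.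
move=> wF; elim: r => [|i r IH].
  under [X in weakly_nulled X]eq_fun do rewrite big_nil.
  by split; [exact: powR_integrable0|exact: weak_null0].
under [X in weakly_nulled X]eq_fun do rewrite big_cons.
have [[iF wFi] [iS wS]] := (wF i, IH).
by split; [exact: powR_integrableD|exact: weak_nullD].
Qed.

Import HBNNSimple.

(** Linearity gives simple functions, increasing simple approximations dominated by [h] itself give
    nonnegative functions, and positive and negative parts give all of [L^q]. *)
Lemma weak_null_indic_all : (mu D < +oo)%E ->
  (forall A, measurable A -> weak_null \1_A) ->
  forall h, powR_integrable q h -> weak_null h.
Proof.
move=> muD wI; have q0 := ltW q_gt0.
have simple (f : {nnsfun T >-> R}) : weakly_nulled f.
  rewrite (_ : (f : T -> R) = fun x =>
      \sum_(y <- finmap.enum_fset (fset_set (range f))) (y * \1_(f @^-1` [set y]) x)).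
    apply: weakly_nulled_sum => y.
    have iI : powR_integrable q (\1_(f @^-1` [set y]) : T -> R).
      exact: powR_integrable_indic.
    by split; [exact: powR_integrableZ|apply: weak_nullZ => //; exact: wI].
  by apply/funext => x; rewrite fimfunE fsbig_finite.
have nneg h : powR_integrable q h -> (forall x, D x -> 0 <= h x) -> weak_null h.
  move=> ih h0; have [mh _] := ih.
  have mhE : measurable_fun D (EFin \o h) by exact/measurable_EFinP.
  have h0E x : D x -> (0 <= (EFin \o h) x)%E by move=> Dx; rewrite lee_fin h0.
  pose s := nnsfun_approx mD mhE.
  have sh m x : D x -> 0 <= s m x <= h x.
    move=> Dx; apply/andP; split; first exact: fun_ge0.
    by rewrite -lee_fin /s nnsfun_approxE; exact: (le_approx m h0E Dx).
  apply: (@weak_null_dominated h (fun m => s m) h) => //.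
  - by move=> m; have [] := simple (s m).
  - by move=> m; have [] := simple (s m).
  - move=> x Dx; have /fine_cvgP[_] := @cvg_nnsfun_approx _ _ _ D mD _ mhE h0E x Dx.
    exact.
  - move=> m x Dx; have /andP[s0 sh'] := sh m x Dx.
    by rewrite !ger0_norm ?subr_ge0 ?h0// lerBlDr lerDl.
move=> h ih; have [mh _] := ih.
pose hp x := Num.max (h x) 0; pose hn x := Num.max (- h x) 0.
have mhp : measurable_fun D hp.
  by apply: measurable_maxr => //; exact: measurable_cst.
have mhn : measurable_fun D hn.
  apply: measurable_maxr; last exact: measurable_cst.
  exact: measurableT_comp.
have ihp : powR_integrable q hp.
  apply: powR_integrable_le ih => // x _; rewrite /hp.
  by case: (lerP (h x) 0) => h0; rewrite ?normr0.
have ihn : powR_integrable q hn.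
  apply: powR_integrable_le ih => // x _; rewrite /hn.
  by case: (lerP (- h x) 0) => h0; rewrite ?normr0 ?normrN.
have -> : h = fun x => hp x - hn x.
  by apply/funext => x; rewrite /hp /hn; case: (lerP (h x) 0); case: (lerP (- h x) 0); lra.
by apply: weak_nullB => //; apply: nneg => // x _; rewrite le_max lexx orbT.
Qed.

End weak_convergence.


(** * Dyadic cubes generate the Borel sets *)

Section dyadic_generation.
Variables (R : realType) (n : nat).
Local Notation tupleR := (n.-tuple (measurableTypeR R)).

(** The empty set is added to make the family stable under intersection: two dyadic cubes are nested
    or disjoint. *)
Definition dyadic_cubes : set (set tupleR) :=
  [set A | A = set0 \/ exists N z, A = @dyadic_cube R n N z].

Lemma setI_closed_dyadic_cubes : setI_closed dyadic_cubes.
Proof.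
move=> A B [->|[N [z ->]]]; first by left; rewrite set0I.
move=> [->|[M [z' ->]]]; first by left; rewrite setI0.
have [->|/set0P[x [xN xM]]] := eqVneq (@dyadic_cube R n N z `&` dyadic_cube M z') set0.
  by left.
have [NM|/ltnW MN] := leqP N M.
  right; exists M, z'; apply: setIidr; exact: dyadic_cube_nested xM.
by right; exists N, z; apply: setIidl; exact: dyadic_cube_nested xN.
Qed.

Lemma dyadic_cube_subray (x : Rn R n) i (a : R) : tnth x i < a ->
  exists N, forall y : Rn R n, gidx N y = gidx N x -> tnth y i < a.
Proof.
move=> xa; have d0 : 0 < a - tnth x i by rewrite subr_gt0.
(* As [k < 2^k], the side [2^-(N+1)] is at most [a - tnth x i], so the cube around [x] stays below
   [a]. *)
pose N := Num.truncn (a - tnth x i)^-1.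
have dN : 1 <= (a - tnth x i) * 2 ^+ N.+1.
  rewrite -ler_pdivrMl// mulr1; apply/ltW.
  apply: lt_le_trans (truncnS_gt _) _.
  by rewrite -natrX ler_nat ltnW// ltn_expl.
exists N.+1 => y yx.
have p2 : 0 < 2 ^+ N.+1 :> R by exact: exprn_gt0.
have : tnth y i * 2 ^+ N.+1 < (gidx N.+1 x i + 1)%:~R.
  by rewrite -yx /gidx floorD1_gt.
rewrite intrD => h; rewrite -(ltr_pM2r p2); apply: lt_le_trans h _.
have : (gidx N.+1 x i)%:~R <= tnth x i * 2 ^+ N.+1 by rewrite /gidx floor_le.
by move: dN; rewrite mulrBl; set u := tnth x i * _; lra.
Qed.

(** A half-space [x_i < a] is the union of the countably many dyadic cubes that it contains, and
    open rays generate the Borel sets of the line. *)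
Lemma measurable_dyadic_generated : @measurable _ tupleR = <<s dyadic_cubes >>.
Proof.
apply/seteqP; split; last first.
  apply: smallest_sub; first exact: sigma_algebra_measurable.
  move=> A [->|[N [z ->]]]; first exact: measurable0.
  by rewrite dyadic_cube_box; exact: measurable_box.
apply: smallest_sub; first exact: smallest_sigma_algebra.
rewrite -bigcup_seq => _ [i _ [B mB <-]]; rewrite setTI.
have : (@ocitv R).-sigma.-measurable B by [].
rewrite RGenInftyO.measurableE.
(* The sets [B] whose preimage under the coordinate is generated by cubes form a sigma-algebra, so
   rays suffice. *)
suff : <<s @RGenInftyO.G R >> `<=`
    [set B | <<s dyadic_cubes >> ((@tnth n (measurableTypeR R))^~ i @^-1` B)] by apply.
apply: smallest_sub.
  split.
  - by rewrite /= preimage_set0; exact: sigma_algebra0.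
  - by move=> A /=; rewrite setTD preimage_setC; exact: sigma_algebraC.
  - by move=> A /= mA; rewrite preimage_bigcup; exact: sigma_algebra_bigcup.
move=> _ [a ->] /=.
pose E (u : nat * {ffun 'I_n -> int}) : set (g_sigma_algebraType dyadic_cubes) :=
  if `[< @dyadic_cube R n u.1 u.2 `<=` [set x | tnth x i < a] >]
  then dyadic_cube u.1 u.2 else set0.
rewrite (_ : _ @^-1` _ = \bigcup_u E u).
  apply: (@countable_bigcupT_measurable _ (g_sigma_algebraType dyadic_cubes)) => // u.
  rewrite /E; case: ifP => _; last exact: measurable0.
  by apply: sub_sigma_algebra; right; exists u.1, u.2.
apply/seteqP; split => x /=.
  rewrite in_itv/= => xa; have [N hN] := dyadic_cube_subray xa.
  exists (N, [ffun j => gidx N x j]) => //; rewrite /E.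
  have e : [ffun j => gidx N x j] = gidx N x :> ('I_n -> int).
    by apply/funext => j; rewrite ffunE.
  rewrite asboolT/=; first by rewrite e; exact: dyadic_cube_gidx.
  by move=> y; rewrite /= e => /dyadic_cubeE /hN.
by move=> [u _]; rewrite /E in_itv/=; case: asboolP => // h /h.
Qed.

End dyadic_generation.

(** * From dyadic cubes to all of [L^q] *)

Section dyadic_weak.
Variables (R : realType) (n : nat).
Local Notation mu := (@lebesgue R n : {measure set (Rn R n) -> \bar R}).
Variables (p q : R).
Hypotheses (p_gt0 : 0 < p) (q_gt0 : 0 < q) (pq : p^-1 + q^-1 = 1).
Variables (N0 : nat) (z0 : 'I_n -> int).
Local Notation Q := (@dyadic_cube R n N0 z0).
Variables (psi : nat -> Rn R n -> R) (K : R).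
Hypothesis ipsi : forall k, powR_integrable mu Q p (psi k).
Hypothesis psiK : forall k, \int[mu]_(x in Q) (`|psi k x| `^ p) <= K.
Hypothesis null_cube : forall ws,
  \int[mu]_(x in dyadic_cube (N0 + size ws) (descend z0 ws)) psi k x @[k --> \oo] --> 0.

Let mQ : measurable Q. Proof. exact: measurable_dyadic_cube. Qed.
Let muQ : (mu Q < +oo)%E. Proof. by rewrite measure_dyadic_cube ltry. Qed.

Lemma descend_gidx x j : Q x ->
  exists ws, size ws = j /\ descend z0 ws = gidx (N0 + j) x.
Proof.
move=> Qx; elim: j => [|j [ws [sz e]]].
  by exists [::]; split => //; rewrite addn0; apply/esym/dyadic_cubeE.
have [w ew] := gidx_subcube (N0 + j) 1 x.
exists (rcons ws w); split; first by rewrite size_rcons sz.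
by rewrite /descend foldl_rcons -/(descend z0 ws) e -ew addn1 addnS.
Qed.

Local Notation wn := (weak_null mu Q psi).

Lemma eq_weak_null h h' : (forall x, Q x -> h x = h' x) -> wn h -> wn h'.
Proof.
move=> hh'; rewrite /weak_null.
suff -> : (fun k => \int[mu]_(x in Q) (psi k x * h x)) =
          (fun k => \int[mu]_(x in Q) (psi k x * h' x)) by [].
by apply/funext => k; apply: eq_Rintegral => x /set_mem Qx; rewrite hh'.
Qed.

Lemma weak_null_subset (A : set (Rn R n)) : A `<=` Q ->
  \int[mu]_(x in A) psi k x @[k --> \oo] --> 0 -> wn \1_A.
Proof.
move=> AQ; rewrite /weak_null.
suff -> : (fun k => \int[mu]_(x in A) psi k x) =
          (fun k => \int[mu]_(x in Q) (psi k x * \1_A x)) by [].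
apply/funext => k; rewrite -{1}(setIidr AQ) Rintegral_mkcondr.
apply: eq_Rintegral => x _; rewrite patchE indicE.
by case: (x \in A); rewrite ?mulr1 ?mulr0.
Qed.

Lemma weak_null_setT : wn \1_setT.
Proof.
apply: (@eq_weak_null \1_Q); first by move=> x Qx; rewrite !indicE !mem_set.
apply: weak_null_subset => //.
by have := null_cube [::]; rewrite /= addn0.
Qed.

Lemma weak_null_dyadic_cube N z : wn \1_(@dyadic_cube R n N z).
Proof.
have [QI|/set0P[x [Qx zx]]] := eqVneq (Q `&` dyadic_cube N z) set0.
  apply: (@eq_weak_null (fun=> 0)); last exact: weak_null0.
  move=> x Qx; rewrite indicE memNset// => zx.
  by have : (Q `&` dyadic_cube N z) x by []; rewrite QI.
have [NN0|/ltnW N0N] := leqP N N0.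
  apply: eq_weak_null weak_null_setT => y Qy.
  rewrite !indicE !mem_set//; exact: (dyadic_cube_nested NN0 zx Qx).
apply: weak_null_subset; first exact: dyadic_cube_nested zx.
have [ws [sz e]] := descend_gidx (N - N0) Qx.
have := null_cube ws; rewrite sz e subnKC//.
by have /dyadic_cubeE -> := zx.
Qed.

(** Dynkin's theorem: complements are differences from the whole space, and disjoint unions are
    limits of partial sums dominated by [1], which lies in [L^q] since [Q] has finite measure. *)
Lemma weak_null_borel (A : set (n.-tuple (measurableTypeR R))) :
  measurable A -> wn \1_A.
Proof.
have iI (B : set (n.-tuple (measurableTypeR R))) : measurable B ->
    powR_integrable mu Q q (\1_B : Rn R n -> R).
  move=> mB; apply: powR_integrable_indic => //; first exact: ltW.
  exact: measurable_borel.
have iT := iI _ measurableT.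
rewrite measurable_dyadic_generated; move: A.
apply: (dynkin_induction (measurable_dyadic_generated R n)
  (@setI_closed_dyadic_cubes R n)) => /=.
- exact: weak_null_setT.
- move=> _ [->|[N [z ->]]]; last exact: weak_null_dyadic_cube.
  apply: (@eq_weak_null (fun=> 0)); last exact: weak_null0.
  by move=> x _; rewrite indic0.
- move=> S mS wS.
  apply: (@eq_weak_null (fun x => \1_setT x - \1_S x)).
    by move=> x _; rewrite !indicE in_setC mem_set//; case: (_ \in _); rewrite ?subrr ?subr0.
  apply: (weak_nullB mQ p_gt0 q_gt0 pq ipsi iT (iI _ mS) weak_null_setT wS).
- move=> F mF tF wF.
  have part m : weakly_nulled mu Q q psi (fun x => \sum_(k <- iota 0 m) \1_(F k) x).
    apply: (weakly_nulled_sum mQ p_gt0 q_gt0 pq ipsi) => k.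
    by split; [exact: iI|exact: wF].
  have sumF m j x : F j x -> \sum_(k <- iota 0 m) \1_(F k) x = (j < m)%:R :> R.
    move=> Fj; transitivity (\sum_(k <- iota 0 m) (k == j)%:R : R).
      apply: eq_bigr => k _; rewrite indicE; case: eqP => [->|/eqP kj].
        by rewrite mem_set.
      rewrite memNset// => Fk; move/trivIsetP : tF => /(_ k j I I kj) /seteqP [+ _].
      by move=> /(_ x) []; split.
    have [jm|mj] := ltnP j m.
      rewrite (bigD1_seq j) ?iota_uniq ?mem_iota//= eqxx big1 ?addr0//.
      by move=> k /negPf ->.
    rewrite big1_seq// => k /=; rewrite mem_iota add0n => /andP[_ km].
    by rewrite ltn_eqF// (leq_trans km).
  have sum0 m x : ~ (\bigcup_k F k) x -> \sum_(k <- iota 0 m) \1_(F k) x = 0 :> R.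
    move=> nF; rewrite big1// => k _; rewrite indicE memNset// => Fk.
    by apply: nF; exists k.
  apply: (weak_null_dominated mQ p_gt0 q_gt0 pq ipsi psiK
    (h_ := fun m x => \sum_(k <- iota 0 m) \1_(F k) x) (g := fun=> 1)).
  + by apply: iI; exact: bigcupT_measurable.
  + exact: powR_integrable_cst.
  + by move=> m; have [] := part m.
  + by move=> m; have [] := part m.
  + move=> x _; apply: cvg_near_cst.
    have [[j _ Fj]|nF] := pselect ((\bigcup_k F k) x).
      exists j.+1 => // m /= jm; rewrite (sumF _ j)// jm indicE mem_set//.
      by exists j.
    by apply: nearW => m; rewrite sum0// indicE memNset.
  + move=> m x _; rewrite normr1.
    have [[j _ Fj]|nF] := pselect ((\bigcup_k F k) x); last first.
      by rewrite sum0// indicE memNset// subr0 normr0.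
    rewrite (sumF _ j)// indicE mem_set; last by exists j.
    by case: (j < m)%N; rewrite ?subrr ?subr0 ?normr0 ?normr1.
Qed.

(** The measure is an infimum over countable Borel covers; [B] is the union of a nearly optimal
    one. *)
Lemma borel_approx (A : set (Rn R n)) (e : R) : measurable A -> (mu A < +oo)%E -> 0 < e ->
  exists B : set (n.-tuple (measurableTypeR R)),
    [/\ measurable B, A `<=` B & (mu (B `\` A) <= e%:E)%E].
Proof.
move=> mA muA e0.
have Afin : mu A \is a fin_num by rewrite ge0_fin_numE.
have [_ [F [mF AF] <-] lt] := lb_ereal_inf_adherent e0 Afin.
have mB : measurable (\bigcup_k F k) by exact: bigcupT_measurable.
exists (\bigcup_k F k); split => //.
have mB' : measurable (\bigcup_k F k : set (Rn R n)) by exact: measurable_borel.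
have muB : (mu (\bigcup_k F k) <= mu A + e%:E)%E.
  apply: le_trans (ltW lt).
  have -> : (\sum_(k <oo) borel_lebesgue R n (F k) = \sum_(k <oo) mu (F k))%E.
    by apply: eq_eseriesr => k _; apply/esym; exact: lebesgue_borel.
  apply: measure_sigma_subadditive => // k; exact: measurable_borel.
have muBfin : (mu (\bigcup_k F k) < +oo)%E.
  by apply: le_lt_trans muB _; rewrite lte_add_pinfty// ltry.
rewrite measureD// (setIidr AF) leeBlDl//.
Qed.

(** The Dynkin argument reaches the Borel sets; other measurable sets are approximated in [L^q] by
    Borel supersets. Intersecting with [Q] first provides the finite measure required by
    [borel_approx]. *)
Lemma weak_null_measurable (A : set (Rn R n)) : measurable A -> wn \1_A.
Proof.
move=> mA; have mAQ : measurable (A `&` Q) by exact: measurableI.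
have q0 := ltW q_gt0.
apply: (@eq_weak_null \1_(A `&` Q)).
  by move=> x Qx; rewrite !indicE in_setI (mem_set Qx) andbT.
apply: (weak_null_closed mQ p_gt0 q_gt0 pq ipsi psiK).
  exact: powR_integrable_indic.
move=> e e0; have muA : (mu (A `&` Q) < +oo)%E.
  by apply: le_lt_trans muQ; apply: le_measure; rewrite ?inE.
have [B [mB AB muB]] := borel_approx mAQ muA e0.
have mB' : measurable (B : set (Rn R n)) by exact: measurable_borel.
exists \1_B; split; [exact: powR_integrable_indic|exact: weak_null_borel|].
have mBA : @measurable _ (Rn R n) (B `\` (A `&` Q)) by exact: measurableD.
rewrite (@eq_Rintegral _ _ _ mu Q (\1_(B `\` (A `&` Q)))); last first.
  move=> x _; rewrite !indicE in_setD; case: (boolP (x \in A `&` Q)) => [/set_mem Ax|_].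
    by rewrite (mem_set (AB _ Ax)) subrr normr0 powR0// gt_eqF.
  rewrite andbT; case: (x \in B); rewrite sub0r normrN ?normr1 ?powR1//.
  by rewrite normr0 powR0// gt_eqF.
rewrite /Rintegral -lee_fin fineK.
  rewrite integral_indic//; apply: le_trans muB; apply: le_measure; rewrite ?inE//.
  exact: measurableI.
rewrite integral_indic// ge0_fin_numE//; apply: le_lt_trans muQ.
by apply: le_measure; rewrite ?inE//; exact: measurableI.
Qed.

Theorem weak_null_dyadic h : powR_integrable mu Q q h -> wn h.
Proof.
apply: (weak_null_indic_all mQ p_gt0 q_gt0 pq ipsi psiK muQ).
exact: weak_null_measurable.
Qed.

End dyadic_weak.


(** * Lower bound for the Bellman function *)

(* In every cube of generation [N + m k] one of its [2^(n m)] descendants of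
   generation [N + m (k+1)], the corner, is marked. A point whose first marked
   ancestor occurs at step [j] gets the value [s^j]; on a cube that meets no
   earlier mark, the average of this function is [s^k r / (1 - s (1 - r))],
   with [r = 2^(-n m)]. *)

Section first_hit.
Variables (R : realType) (n m : nat).
Local Notation mu := (@lebesgue R n : {measure set (Rn R n) -> \bar R}).
Local Notation r := (vol R n m).
Implicit Types (N j : nat) (x y : Rn R n) (s : R).

(** Divisibility of every coordinate of the index by [2 ^ m] says that [x] lies in the descendant
    with all remainders zero, the [corner]. *)
Definition hit N x := [forall i : 'I_n, ((2 ^ m)%N %| gidx (N + m) x i)%Z].

Definition corner : {ffun 'I_n -> 'I_(2 ^ m)} :=
  [ffun=> Ordinal (expn_gt0 2 m)].

Lemma hit_subcube N z w x : dyadic_cube (N + m) (subcube m z w) x ->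
  hit N x = (w == corner).
Proof.
move=> /dyadic_cubeE e; apply/forallP/eqP => [h|wc i]; last first.
  by rewrite e wc /subcube /corner ffunE /= addr0 dvdz_mull.
apply/ffunP => i; apply/val_inj; rewrite /corner ffunE /=.
have := h i; rewrite e /subcube => /dvdz_mod0P.
rewrite modzMDl modz_nat => -[]; rewrite modn_small//; exact: ltn_ord.
Qed.

Fixpoint first_hit j N : set (Rn R n) :=
  if j is j'.+1 then [set x | ~~ hit N x] `&` first_hit j' (N + m)
  else [set x | hit N x].

Lemma first_hit_inj i j N x : first_hit i N x -> first_hit j N x -> i = j.
Proof.
elim: i j N => [|i IH] [|j] N//=.
- by move=> hx [/negP].
- by move=> [/negP].
- by move=> [_ hi] [_ hj]; rewrite (IH _ _ hi hj).
Qed.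

Lemma measurable_first_hit j N : measurable (first_hit j N).
Proof.
have mh M : measurable [set x | hit M x].
  have := @measurable_fun_gidx R n (M + m)
    (fun g => ([forall i : 'I_n, ((2 ^ m)%N %| g i)%Z] : bool)%:R).
  move=> /(_ measurableT [set 1] (measurable_set1 _)); rewrite setTI.
  congr (measurable _); apply/seteqP; split => x; rewrite /= /hit; last by move=> ->.
  by case: [forall _, _] => // /eqP; rewrite eq_sym oner_eq0.
elim: j N => [|j IH] N /=; first exact: mh.
apply: measurableI => //.
rewrite (_ : [set x | ~~ hit N x] = ~` [set x | hit N x]); first exact: measurableC.
by apply/seteqP; split => x /negP.
Qed.

(** A geometric law: one of the [1 / r] descendants is marked, a fraction [r] of the volume, and in
    each of the others the count starts afresh. *)
Lemma integral_first_hit j N z :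
  (\int[mu]_(x in dyadic_cube N z) (\1_(first_hit j N) x)%:E =
   (vol R n N * (r * (1 - r) ^+ j))%:E)%E.
Proof.
have B1 := card_subcube R n m.
have mI i M : measurable_fun setT (fun x => (\1_(first_hit i M) x)%:E : \bar R).
  exact/measurable_EFinP/measurable_indic/measurable_first_hit.
have I0 i M x : (0 <= (\1_(first_hit i M) x)%:E :> \bar R)%E by rewrite lee_fin.
elim: j N z => [|j IH] N z; rewrite (ge0_integral_subcube N m z (mI _ _) (I0 _ _)).
- rewrite (bigD1 corner)//= big1 ?adde0.
    rewrite (@eq_integral _ _ _ mu _ (cst 1%E)).
      rewrite integral_cst; last exact: measurable_dyadic_cube.
      by rewrite measure_dyadic_cube mul1e volD expr0 mulr1.
    by move=> x /set_mem /hit_subcube h; rewrite indicE mem_set//= h eqxx.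
  move=> w wc; rewrite (@eq_integral _ _ _ mu _ (cst 0%E)) ?integral0//.
  move=> x /set_mem /hit_subcube h; rewrite indicE memNset//= h.
  exact/negP.
- rewrite (bigD1 corner)//= [X in (X + _)%E](_ : _ = 0%E) ?add0e; last first.
    rewrite (@eq_integral _ _ _ mu _ (cst 0%E)) ?integral0//.
    move=> x /set_mem /hit_subcube h; rewrite indicE memNset//= h eqxx.
    by case.
  rewrite (eq_bigr (fun=> (vol R n (N + m) * (r * (1 - r) ^+ j))%:E)); last first.
    move=> w /negPf wc; rewrite -(IH _ (subcube m z w)).
    apply: eq_integral => x /set_mem /hit_subcube h; rewrite !indicE.
    congr (_%:R%:E); congr nat_of_bool; rewrite !in_setI /=.
    by rewrite [X in X && _]mem_set//= h wc.
  rewrite sumEFin; congr (_%:E); rewrite sumr_const -mulr_natl volD exprS.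
  have -> : #|[pred w | w != corner]|%:R = #|{ffun 'I_n -> 'I_(2 ^ m)}|%:R - 1 :> R.
    rewrite (@eq_card _ _ (predC1 corner))// cardC1 -subn1 natrB//.
    by apply/card_gt0P; exists corner.
  set B := _%:R in B1 *.
  have -> : (B - 1) * (vol R n N * r * (r * (1 - r) ^+ j)) =
     (B * r - r) * (vol R n N * (r * (1 - r) ^+ j)) by ring.
  by rewrite B1; ring.
Qed.

(* For each [x] the sum has at most one nonzero term (see [first_hit_inj]). *)
Definition profile s N x : \bar R := (\sum_(j <oo) (s ^+ j * \1_(first_hit j N) x)%:E)%E.

Lemma profile_hit s j N x : first_hit j N x -> profile s N x = (s ^+ j)%:E.
Proof.
move=> hx; apply: (@lim_near_cst) => //; exists j.+1 => // k /= jk.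
rewrite big_mkord (bigD1 (Ordinal jk))//= indicE mem_set// mulr1 big1 ?adde0// => i ij.
rewrite indicE memNset ?mulr0// => hi; move/negP: ij; apply; apply/eqP/val_inj.
exact: first_hit_inj hi hx.
Qed.

Lemma profile_nohit s N x : (forall j, ~ first_hit j N x) -> profile s N x = 0%E.
Proof.
move=> nh; apply: eseries0 => j _ _.
by rewrite indicE memNset// mulr0.
Qed.

Lemma profile_ge0 s N x : 0 <= s -> (0 <= profile s N x)%E.
Proof.
by move=> s0; apply: nneseries_ge0 => j _ _; rewrite lee_fin mulr_ge0 ?exprn_ge0.
Qed.

Lemma profile_fin s N x : profile s N x \is a fin_num.
Proof.
have [[j hj]|nh] := pselect (exists j, first_hit j N x).
  by rewrite (profile_hit _ hj).
by rewrite profile_nohit// => j hj; apply: nh; exists j.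
Qed.

(** With at most one nonzero term in the sum, taking powers only replaces [s] by [s^p]; the [p]-th
    moment then follows from the formula for the mean. *)
Lemma profile_powR s N x p : 0 <= s -> 0 < p ->
  fine (profile s N x) `^ p = fine (profile (s `^ p) N x).
Proof.
move=> s0 p0; have [[j hj]|nh] := pselect (exists j, first_hit j N x).
  rewrite (profile_hit s hj) (profile_hit (s `^ p) hj) /=.
  by rewrite -(powR_mulrn j s0) -(powR_mulrn j (powR_ge0 s p)) powRAC.
have {}nh j : ~ first_hit j N x by move=> hj; apply: nh; exists j.
by rewrite !profile_nohit//= powR0// gt_eqF.
Qed.

Lemma profile_shift s N x : ~~ hit N x -> profile s N x = (s%:E * profile s (N + m) x)%E.
Proof.
move=> hx; have [[j hj]|nh] := pselect (exists j, first_hit j (N + m) x).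
  by rewrite (profile_hit s hj) (@profile_hit s j.+1)//= exprS.
have {}nh j : ~ first_hit j (N + m) x by move=> hj; apply: nh; exists j.
rewrite !profile_nohit ?mule0// => -[|j] /=; first exact/negP.
by case=> _; exact: nh.
Qed.

(** Self-similarity: [x] meets no mark in its first [k] steps, and neither does any other point of
    its cube of generation [N + m * k]. *)
Lemma profile_shifts s k N x y : first_hit k N x ->
  gidx (N + m * k) y = gidx (N + m * k) x ->
  profile s N y = ((s ^+ k)%:E * profile s (N + m * k) y)%E.
Proof.
elim: k N => [|k IH] N /=; first by rewrite muln0 addn0 mul1e.
move=> [hx hk]; rewrite mulnS addnA => e.
have e1 : gidx (N + m) y = gidx (N + m) x by apply: gidx_le e; rewrite leq_addr.
rewrite profile_shift; last by rewrite /hit e1.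
by rewrite (IH _ hk e) muleA -EFinM exprS.
Qed.

Lemma measurable_profile s N : 0 <= s -> measurable_fun setT (profile s N).
Proof.
move=> s0; apply: ge0_emeasurable_sum.
  by move=> j x _ _; rewrite lee_fin mulr_ge0 ?exprn_ge0.
move=> j _; apply/measurable_EFinP; apply: measurable_funM; first exact: measurable_cst.
exact/measurable_indic/measurable_first_hit.
Qed.

Lemma integral_profile s N z : 0 <= s -> s * (1 - r) < 1 ->
  (\int[mu]_(x in dyadic_cube N z) profile s N x =
   (vol R n N * (r / (1 - s * (1 - r))))%:E)%E.
Proof.
move=> s0 sr; rewrite integral_nneseries; last 3 first.
- exact: measurable_dyadic_cube.
- move=> j; apply/measurable_funTS/measurable_EFinP.
  apply: measurable_funM; first exact: measurable_cst.
  exact/measurable_indic/measurable_first_hit.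
- by move=> j x _; rewrite lee_fin mulr_ge0 ?exprn_ge0.
have E j : (\int[mu]_(x in dyadic_cube N z) (s ^+ j * \1_(first_hit j N) x)%:E =
    (vol R n N * r * (s * (1 - r)) ^+ j)%:E)%E.
  under eq_integral do rewrite EFinM.
  have mI : measurable_fun (dyadic_cube N z) (fun x => (\1_(first_hit j N) x)%:E : \bar R).
    exact/measurable_funTS/measurable_EFinP/measurable_indic/measurable_first_hit.
  have I0 x : dyadic_cube N z x -> (0 <= (\1_(first_hit j N) x)%:E :> \bar R)%E.
    by rewrite lee_fin.
  rewrite (ge0_integralZl_EFin mu (measurable_dyadic_cube N z) I0 mI (exprn_ge0 j s0)).
  by rewrite integral_first_hit -EFinM exprMn; congr (_%:E); ring.
under eq_eseriesr do rewrite E.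
have sr0 : 0 <= s * (1 - r) by apply: mulr_ge0; [exact: s0|rewrite subr_ge0; exact: vol_le1].
have := @cvg_geometric_series R (vol R n N * r) (s * (1 - r)).
rewrite ger0_norm// => /(_ sr) h.
rewrite mulrA; apply/cvg_lim => //.
rewrite (_ : (fun _ => _) = EFin \o series (geometric (vol R n N * r) (s * (1 - r)))).
  by apply: cvg_EFin; [exact: nearW|exact: h].
by apply/funext => k; rewrite /series /= -sumEFin.
Qed.

End first_hit.


Section competitor.
Variables (R : realType) (n m : nat) (p f F s c : R).
Variables (N0 : nat) (z0 : 'I_n -> int).
Local Notation mu := (@lebesgue R n : {measure set (Rn R n) -> \bar R}).
Local Notation Q := (@dyadic_cube R n N0 z0).
Local Notation r := (vol R n m).
Hypotheses (p_gt1 : 1 < p) (s_ge0 : 0 <= s) (c_ge0 : 0 <= c).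
Hypotheses (sr : s * (1 - r) < 1) (spr : s `^ p * (1 - r) < 1).
Let W := r / (1 - s * (1 - r)).
Hypotheses (fE : f = c * W) (FE : F = c `^ p * (r / (1 - s `^ p * (1 - r)))).

Let p_gt0 : 0 < p. Proof. exact: lt_trans p_gt1. Qed.
Let W_ge0 : 0 <= W.
Proof. by apply: divr_ge0; [exact/ltW/vol_gt0|rewrite subr_ge0 ltW]. Qed.
Let mQ : measurable Q. Proof. exact: measurable_dyadic_cube. Qed.

Definition competitor : Rn R n -> R :=
  (fun x => c * fine (profile m s N0 x)) \_ Q.

Lemma competitorE x : Q x -> competitor x = c * fine (profile m s N0 x).
Proof. by move=> Qx; rewrite /competitor patchE mem_set. Qed.

Lemma competitor_supp x : ~ Q x -> competitor x = 0.
Proof. by move=> Qx; rewrite /competitor patchE memNset. Qed.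

Lemma competitor_ge0 x : 0 <= competitor x.
Proof.
have [Qx|Qx] := pselect (Q x); last by rewrite competitor_supp.
by rewrite competitorE// mulr_ge0// fine_ge0// profile_ge0.
Qed.

Lemma measurable_competitor : measurable_fun setT competitor.
Proof.
apply/(measurable_restrictT _ mQ)/measurable_funTS.
apply: measurable_funM; first exact: measurable_cst.
apply: (measurableT_comp (fine_measurable measurableT)).
exact: measurable_profile.
Qed.

Lemma integral_competitor_powR (t : R) : 0 < t -> s `^ t * (1 - r) < 1 ->
  (\int[mu]_(x in Q) (competitor x `^ t)%:E =
   (vol R n N0 * (c `^ t * (r / (1 - s `^ t * (1 - r)))))%:E)%E.
Proof.
move=> t0 str.
have st0 : 0 <= s `^ t by exact: powR_ge0.
transitivity (\int[mu]_(x in Q) ((c `^ t)%:E * profile m (s `^ t) N0 x))%E.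
  apply: eq_integral => x /set_mem Qx.
  rewrite competitorE// powRM//; last by rewrite fine_ge0// profile_ge0.
  by rewrite profile_powR// EFinM fineK// profile_fin.
have mprof : measurable_fun Q (profile m (s `^ t) N0).
  exact/measurable_funTS/measurable_profile.
have prof0 x : Q x -> (0 <= profile m (s `^ t) N0 x)%E.
  by move=> _; exact: profile_ge0.
rewrite (ge0_integralZl_EFin mu mQ prof0 mprof (powR_ge0 c t)).
by rewrite integral_profile// -EFinM mulrCA.
Qed.

Lemma integral_competitor :
  (\int[mu]_(x in Q) (competitor x)%:E = (vol R n N0 * f)%:E)%E.
Proof.
have := @integral_competitor_powR 1 ltr01; rewrite !powRr1// => /(_ sr) h.
rewrite fE -h; apply: eq_integral => x _.
by rewrite powRr1// competitor_ge0.
Qed.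

Lemma competitor_admissible : admissible p Q f F competitor.
Proof.
split.
- exact: measurable_competitor.
- exact: competitor_ge0.
- exact: competitor_supp.
- by apply/average_eqP; exact: integral_competitor.
- by apply/average_eqP; rewrite integral_competitor_powR// FE.
Qed.

(** On the cube of generation [N0 + m * k] around a point first marked at step [k], the function is
    [c s^k] times a fresh profile; its average [c s^k W] is [W] times the value at the point. Points
    never marked have value [0]. *)
Lemma competitor_maximal x : Q x ->
  ((W * competitor x)%:E <= dyadic_maximal competitor x)%E.
Proof.
move=> Qx.
have [[k hk]|nh] := pselect (exists k, first_hit m k N0 x); last first.
  rewrite competitorE// profile_nohit; last by move=> j hj; apply: nh; exists j.
  rewrite /= !mulr0; apply: le_trans (ereal_sup_ubound _); last first.
    by exists Q => //; split => //; exists N0, z0.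
  rewrite average_mean; last 3 first.
  - exact: measurable_competitor.
  - exact: competitor_ge0.
  - exact: (admissible_fin competitor_admissible).
  by rewrite lee_fin mean_ge0//; exact: competitor_ge0.
pose M := (N0 + m * k)%N; pose J : set (Rn R n) := dyadic_cube M (gidx M x).
have JQ : J `<=` Q.
  apply: (dyadic_cube_nested (leq_addr _ _) Qx); exact: dyadic_cube_gidx.
suff -> : ((W * competitor x)%:E = average J (fun u => `|competitor u|%:E))%E.
  apply: ereal_sup_ubound; exists J => //; split; last exact: dyadic_cube_gidx.
  by exists M, (gidx M x).
apply/esym/average_eqP.
have ck0 : 0 <= c * s ^+ k by rewrite mulr_ge0// exprn_ge0.
transitivity (\int[mu]_(u in J) ((c * s ^+ k)%:E * profile m s M u))%E.
  apply: eq_integral => y /set_mem Jy.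
  rewrite ger0_norm ?competitor_ge0// competitorE; last exact: JQ.
  have -> := @profile_shifts R n m s k N0 x y hk; last exact/dyadic_cubeE.
  by rewrite fineM ?profile_fin//= mulrA EFinM fineK// profile_fin.
have mJ : measurable J by exact: measurable_dyadic_cube.
have mprof : measurable_fun J (profile m s M).
  exact/measurable_funTS/measurable_profile.
have prof0 y : J y -> (0 <= profile m s M y)%E by move=> _; exact: profile_ge0.
rewrite (ge0_integralZl_EFin mu mJ prof0 mprof ck0).
rewrite integral_profile// -EFinM competitorE// (profile_hit s hk)/=.
by rewrite -/W; congr (_%:E); ring.
Qed.

Lemma bellman_ge_competitor : ((W `^ p * F)%:E <= bellman p Q f F)%E.
Proof.
have adm := competitor_admissible.
apply: (@le_trans _ _ (maximal_average p Q competitor)); last first.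
  by apply: ereal_sup_ubound; exists competitor.
rewrite /maximal_average average_dyadic_cube.
have v0 := vol_gt0 R n N0.
rewrite (_ : (W `^ p * F)%:E =
  (vol R n N0)^-1%:E * (vol R n N0 * (W `^ p * F))%:E)%E; last first.
  by rewrite -EFinM mulKf// gt_eqF.
apply: lee_wpmul2l; first by rewrite lee_fin invr_ge0 ltW.
have mphip : measurable_fun Q (fun x => (competitor x `^ p)%:E).
  apply/measurable_funTS/measurable_EFinP.
  by apply: (measurableT_comp (measurable_powR p)); exact: measurable_competitor.
have phip0 x : Q x -> (0 <= (competitor x `^ p)%:E)%E by rewrite lee_fin powR_ge0.
rewrite mulrCA EFinM -(admissible_intp adm).
rewrite -(ge0_integralZl_EFin mu mQ phip0 mphip (powR_ge0 W p)).
apply: ge0_le_integral.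
- exact: mQ.
- by move=> x _; rewrite -EFinM lee_fin mulr_ge0 ?powR_ge0.
- exact: measurable_funeM.
- apply: (measurable_dyadic_maximal_powR p_gt1 measurable_competitor competitor_ge0
    (admissible_fin adm) (N0 := N0) (z0 := z0) competitor_supp).
- move=> x Qx; rewrite -EFinM -powRM// ?competitor_ge0// -poweR_EFin.
  apply: le_poweR; first exact: ltW.
    by rewrite lee_fin mulr_ge0// competitor_ge0.
  exact: competitor_maximal.
Qed.

End competitor.


(** * Existence of [om] and of the parameters of the competitor *)

Section parameters.
Variables (R : realType) (p : R).
Hypothesis p_gt1 : 1 < p.
Implicit Types f F W om x y r : R.

Let p_gt0 : 0 < p. Proof. exact: lt_trans p_gt1. Qed.
Let p1_gt0 : 0 < p - 1. Proof. by rewrite subr_gt0. Qed.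

Definition H_p (z : R) : R := p * z `^ (p - 1) - (p - 1) * z `^ p.

Lemma continuous_powR (a x : R) : 0 < x -> {for x, continuous (@powR R ^~ a)}.
Proof.
move=> x0; apply/differentiable_continuous/derivable1_diffP.
by apply: derivable_powR; rewrite in_itv/= x0.
Qed.

Lemma H_p_surj x : 0 < x <= 1 -> exists2 om, 1 <= om & H_p om = x.
Proof.
move=> /andP[x0 x1]; pose b := p / (p - 1).
have b1 : 1 <= b by rewrite ler_pdivlMr// mul1r lerBlDr lerDl.
have H1 : H_p 1 = 1 by rewrite /H_p !powR1; ring.
have Hb : H_p b = 0.
  have b0 : 0 <= b by exact: le_trans b1.
  rewrite /H_p -(powR_pred p_gt1 b0) /b; field; exact: lt0r_neq0.
have [||om] := @IVT R H_p 1 b x b1.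
- apply: continuous_in_subspaceT => z /set_mem /=; rewrite in_itv/= => /andP[z1 _].
  have z0 : 0 < z by exact: lt_le_trans z1.
  by apply: cvgB; apply: cvgMr; exact: continuous_powR.
- by rewrite H1 Hb ge_min le_max x1 (ltW x0) orbT.
- by rewrite in_itv/= => /andP[om1 _] <-; exists om.
Qed.

Lemma H_p_decr a b : 1 < a -> a < b -> H_p b < H_p a.
Proof.
move=> a1 ab; have a0 : 0 <= a by rewrite (le_trans _ (ltW a1)).
have b0 : 0 <= b by exact: le_trans (ltW ab).
have := young_powR p_gt1 a0 b0.
have := powR_pred_lt p_gt1 a0 ab.
rewrite /H_p -(powR_pred p_gt1 a0) -(powR_pred p_gt1 b0).
set u := a `^ _; set v := b `^ _ => uv h.
(* Young's inequality bounds [H_p a - H_p b] from below by this quantity, positive because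
   [a > 1]. *)
have : 0 < p * ((a - 1) * (v - u)) by rewrite !mulr_gt0// subr_gt0.
by lra.
Qed.

Lemma expR_ge_1sub x : x < 1 -> expR (- (x / (1 - x))) <= 1 - x.
Proof.
move=> x1; have x1' : 0 < 1 - x by rewrite subr_gt0.
rewrite expRN invf_ple ?posrE ?expR_gt0//.
apply: le_trans (expR_ge1Dx _).
by rewrite le_eqVlt; apply/orP; left; apply/eqP; field; exact: lt0r_neq0.
Qed.

(* Both sides are [1] at [r = 0]; the last hypothesis says that the slope of
   the left-hand side is smaller, with room for the second-order terms. *)
Lemma powR_ratio_le W y r : 1 <= W -> 0 < y -> 0 < r -> r <= 2^-1 -> r * y <= 2^-1 ->
  r * (2 * (p - 1) + 2 * y ^+ 2) <= p / W - (p - 1) - y ->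
  (1 - r / W) `^ p <= (1 - r * y) * (1 - r) `^ (p - 1).
Proof.
move=> W1 y0 r0 r2 ry2 hr.
have W0 : 0 < W by exact: lt_le_trans W1.
have r1 : r < 1 by lra.
have ry1 : r * y < 1 by lra.
have rW : r / W <= r by rewrite ler_pdivrMr// ler_peMr// ltW.
(* The two sides are compared through exponentials: [1 - x <= exp(-x)] on the left,
   [1 - x >= exp(-x / (1 - x))] on the right. *)
apply: (@le_trans _ _ (expR (- (r / W) * p))).
  rewrite expRM; apply: ge0_ler_powR; rewrite ?nnegrE ?(ltW p_gt0) ?expR_ge0//.
    by lra.
  by apply: le_trans (expR_ge1Dx _).
apply: (@le_trans _ _ (expR (- (r * y / (1 - r * y))) * expR (- (r / (1 - r)) * (p - 1)))).
  rewrite -expRD ler_expR.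
  (* This bound is the source of the factors [2] in the hypothesis on the slope. *)
  have aux x : 0 < x -> x <= 2^-1 -> x / (1 - x) <= x * (1 + 2 * x).
    move=> x0 x2; rewrite ler_pdivrMr; last by lra.
    by rewrite -mulrA ler_peMr ?(ltW x0)//; nra.
  have h1 := aux _ r0 r2.
  have h2 := aux _ (mulr_gt0 r0 y0) ry2.
  have h3 : r / (1 - r) * (p - 1) <= r * (1 + 2 * r) * (p - 1).
    by rewrite ler_pM2r.
  have h4 : r * (r * (2 * (p - 1) + 2 * y ^+ 2)) <= r * (p / W - (p - 1) - y).
    by rewrite ler_pM2l.
  have -> : - (r / W) * p = - (r * (p / W)) by ring.
  rewrite mulNr; move: h2 h3 h4; rewrite expr2.
  set u := p / W; set v := r * y / _; set w := r / _ * _; nra.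
apply: ler_pM; [exact: expR_ge0|exact: expR_ge0|exact: expR_ge_1sub|].
rewrite expRM; apply: ge0_ler_powR; rewrite ?nnegrE ?(ltW p1_gt0) ?expR_ge0//.
  by lra.
exact: expR_ge_1sub.
Qed.

(** In dimension zero every volume is [1]: this is where [n > 0] enters. *)
Lemma vol_small n (e : R) : (0 < n)%N -> 0 < e -> exists m, vol R n m < e.
Proof.
move=> n0 e0; pose m := (Num.truncn e^-1).+1; exists m.
have p2 : 0 < 2 ^+ m :> R by exact: exprn_gt0.
have le1 : (2 ^+ m)^-1 <= 1 :> R by rewrite invf_le1// exprn_ege1// ler1n.
apply: (@le_lt_trans _ _ (2 ^+ m)^-1).
  rewrite /vol -[leRHS]expr1; by apply: ler_wiXn2l.
rewrite invf_plt ?posrE//; apply: lt_trans (truncnS_gt _) _.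
by rewrite -natrX ltr_nat ltn_expl.
Qed.

(* [s] comes from the intermediate value theorem: at
   [s = (1 - r / W) / (1 - r)] the function with mean [f] has [p]-th moment at
   most [F], and this moment blows up as [s `^ p * (1 - r)] tends to [1]. *)
Lemma competitor_parameters f F W r : 0 < f -> 0 < F -> 1 <= W ->
  0 < r -> r < 1 ->
  (1 - r / W) `^ p <= (1 - r * (f `^ p / (F * W `^ p))) * (1 - r) `^ (p - 1) ->
  exists s c, [/\ [/\ 0 <= s, 0 <= c, s * (1 - r) < 1 & s `^ p * (1 - r) < 1],
    f = c * (r / (1 - s * (1 - r))),
    F = c `^ p * (r / (1 - s `^ p * (1 - r))) &
    W <= r / (1 - s * (1 - r))].
Proof.
move=> f0 F0 W1 r0 r1 hr.
have W0 : 0 < W by exact: lt_le_trans W1.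
have q0 : 0 < 1 - r by rewrite subr_gt0.
have rW : r / W <= r by rewrite ler_pdivrMr// ler_peMr// ltW.
have rW0 : 0 < r / W by rewrite divr_gt0.
(* At [sW] the ratio [r / (1 - s (1 - r))] of the mean to the coefficient [c] equals [W]. *)
pose sW := (1 - r / W) / (1 - r).
have sW0 : 0 < sW by rewrite divr_gt0//; lra.
have sWr : 1 - sW * (1 - r) = r / W by rewrite /sW divfK ?gt_eqF//; ring.
pose s1 := (1 - r) `^ (- p^-1).
have s1p : s1 `^ p * (1 - r) = 1.
  by rewrite /s1 -powRrM mulNr mulVf ?gt_eqF// powR_inv1 ?(ltW q0)// mulVf// gt_eqF.
have s10 : 0 < s1 by rewrite powR_gt0.
have s1r : s1 * (1 - r) < 1.
  have : (s1 * (1 - r)) `^ p < 1 `^ p.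
    rewrite powRM ?(ltW s10) ?(ltW q0)// -(powR_pred p_gt1 (ltW q0)) mulrA s1p mul1r powR1.
    have q1 : 1 - r < 1 by lra.
    by have := powR_pred_lt p_gt1 (ltW q0) q1; rewrite powR1.
  move=> h; rewrite ltNge; apply/negP => h1.
  have : 1 `^ p <= (s1 * (1 - r)) `^ p.
    by apply: ge0_ler_powR; rewrite ?nnegrE ?(ltW p_gt0)// mulr_ge0// ltW.
  by rewrite leNgt h.
have sWp : sW `^ p * (1 - r) <= 1 - r * (f `^ p / (F * W `^ p)).
  rewrite /sW powRM; [|lra|by rewrite invr_ge0 ltW].
  rewrite -(powR_inv1 (ltW q0)) -powRrM mulN1r powRN.
  rewrite -(powR_pred p_gt1 (ltW q0)) invfM -mulrA mulrAC mulVf ?gt_eqF// mul1r.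
  by rewrite ler_pdivrMr ?powR_gt0.
have Wp0 : 0 < W `^ p by rewrite powR_gt0.
have fp0 : 0 < f `^ p by rewrite powR_gt0.
have sWs1 : sW <= s1.
  rewrite leNgt; apply/negP => h.
  have : s1 `^ p < sW `^ p.
    by apply: gt0_ltr_powR; rewrite ?nnegrE ?(ltW s10) ?(ltW sW0).
  rewrite -(ltr_pM2r q0) s1p => h1.
  have : 0 < r * (f `^ p / (F * W `^ p)) by rewrite mulr_gt0// divr_gt0// mulr_gt0.
  by lra.
(* For [s < s1], [K s] has the sign of [F] minus the [p]-th moment of the function with mean [f].
   Clearing the denominator [1 - s^p (1 - r)] keeps [K] continuous up to [s1], where it vanishes. *)
pose K s := F * (1 - s `^ p * (1 - r)) - r * (f * (1 - s * (1 - r)) / r) `^ p.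
have KW : 0 <= K sW.
  rewrite /K sWr subr_ge0.
  have -> : f * (r / W) / r = f / W by field; rewrite !gt_eqF.
  have -> : (f / W) `^ p = f `^ p / W `^ p.
    rewrite powRM ?(ltW f0) ?invr_ge0 ?(ltW W0)//.
    by rewrite -(powR_inv1 (ltW W0)) -powRrM mulN1r powRN.
  rewrite -ler_pdivrMl//; apply: (@le_trans _ _ (r * (f `^ p / (F * W `^ p)))); last by lra.
  by rewrite le_eqVlt; apply/orP; left; apply/eqP; field; rewrite !gt_eqF.
have K1 : K s1 < 0.
  rewrite /K s1p subrr mulr0 sub0r oppr_lt0 mulr_gt0// powR_gt0//.
  by rewrite divr_gt0// mulr_gt0// subr_gt0.
have [||s] := @IVT R K sW s1 0 sWs1.
- apply: continuous_in_subspaceT => z /set_mem /=; rewrite in_itv/= => /andP[zW z1].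
  have z0 : 0 < z by exact: lt_le_trans zW.
  have zr : z * (1 - r) < 1 by apply: le_lt_trans s1r; rewrite ler_pM2r.
  apply: cvgB; apply: cvgMr.
    apply: cvgB; first exact: cvg_cst.
    by apply: cvgMl; exact: continuous_powR.
  apply: (@cvg_comp _ _ _ (fun s => f * (1 - s * (1 - r)) / r) (@powR R ^~ p)
    _ (nbhs (f * (1 - z * (1 - r)) / r))).
    apply: cvgMl; apply: cvgMr; apply: cvgB; first exact: cvg_cst.
    by apply: cvgMl; exact: cvg_id.
  apply: continuous_powR; rewrite divr_gt0// mulr_gt0// subr_gt0//.
- by rewrite ge_min le_max KW (ltW K1) orbT.
rewrite in_itv/= => /andP[Ws ss1] Ks.
have s0 : 0 < s by exact: lt_le_trans Ws.
have sr : s * (1 - r) < 1 by apply: le_lt_trans s1r; rewrite ler_pM2r.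
have s_lt : s < s1.
  by rewrite lt_neqAle ss1 andbT; apply/eqP => e; move: K1; rewrite -e Ks ltxx.
have spr : s `^ p * (1 - r) < 1.
  rewrite -[ltRHS]s1p ltr_pM2r//; apply: gt0_ltr_powR; rewrite ?nnegrE ?(ltW s0) ?(ltW s10)//.
have sr' : 0 < 1 - s * (1 - r) by rewrite subr_gt0.
have spr' : 0 < 1 - s `^ p * (1 - r) by rewrite subr_gt0.
exists s, (f * (1 - s * (1 - r)) / r); split.
- split=> //; first exact: ltW.
  by rewrite ltW// divr_gt0// mulr_gt0.
- by field; rewrite !gt_eqF.
- have Ks' : F * (1 - s `^ p * (1 - r)) = r * (f * (1 - s * (1 - r)) / r) `^ p.
    by apply/eqP; rewrite -subr_eq0 -/(K s) Ks.
  by rewrite -[LHS](mulfK (lt0r_neq0 spr')) Ks' [RHS]mulrCA mulrA.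
- rewrite ler_pdivlMr// mulrC -ler_pdivlMr// -sWr lerD2l lerN2.
  by rewrite ler_pM2r.
Qed.

End parameters.

Section bellman_lower_bound.
Variables (R : realType) (n : nat) (p f F om : R) (N0 : nat) (z0 : 'I_n -> int).
Hypotheses (n_gt0 : (0 < n)%N) (p_gt1 : 1 < p) (f_gt0 : 0 < f) (F_gt0 : 0 < F).
Hypotheses (om_gt1 : 1 < om) (fF : f `^ p = F * H_p p om).
Local Notation Q := (@dyadic_cube R n N0 z0).

Let p_gt0 : 0 < p. Proof. exact: lt_trans p_gt1. Qed.
Let p1_gt0 : 0 < p - 1. Proof. by rewrite subr_gt0. Qed.

(** [W < om] gives [H_p W > H_p om], which after division by [W^p] is the strict slope inequality
    [p / W - (p - 1) > y]; [powR_ratio_le] then applies for all small [r]. *)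
Lemma bellman_ge_lt W : 1 < W -> W < om -> ((W `^ p * F)%:E <= bellman p Q f F)%E.
Proof.
move=> W1 Wom; have W0 : 0 < W by exact: lt_trans W1.
have Wp0 : 0 < W `^ p by rewrite powR_gt0.
pose y := f `^ p / (F * W `^ p).
have y0 : 0 < y by rewrite divr_gt0 ?powR_gt0// mulr_gt0.
have d0 : 0 < p / W - (p - 1) - y.
  have := H_p_decr p_gt1 W1 Wom => hW.
  have -> : y = H_p p om / W `^ p by rewrite /y fF; field; rewrite !gt_eqF.
  rewrite subr_gt0 ltr_pdivrMr//; apply: lt_le_trans hW _.
  rewrite /H_p -(powR_pred p_gt1 (ltW W0)) le_eqVlt; apply/orP; left.
  by apply/eqP; field; rewrite gt_eqF.
pose C := 2 * (p - 1) + 2 * y ^+ 2.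
have C0 : 0 < C by rewrite addr_gt0// mulr_gt0// exprn_gt0.
(* One bound for each smallness condition of [powR_ratio_le]: on [r], on [r * y] and on the
   slope. *)
pose e := Num.min 2^-1 (Num.min (2^-1 / y) ((p / W - (p - 1) - y) / C)).
have e0 : 0 < e by rewrite !lt_min invr_gt0 ltr0n divr_gt0// divr_gt0.
have [m] := @vol_small R n e n_gt0 e0.
rewrite !lt_min => /and3P[r2 ry rC].
have r0 := vol_gt0 R n m; set r := vol R n m in r0 r2 ry rC.
have r1 : r < 1 by lra.
have key : (1 - r / W) `^ p <= (1 - r * y) * (1 - r) `^ (p - 1).
  apply: powR_ratio_le => //; first exact: ltW.
  - exact: ltW.
  - by rewrite -ler_pdivlMr// ltW.
  - by rewrite -ler_pdivlMr// ltW.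
have [s [c [[s0 c0 sr spr] fE FE WE]]] :=
  competitor_parameters p_gt1 f_gt0 F_gt0 (ltW W1) r0 r1 key.
apply: le_trans (@bellman_ge_competitor R n m p f F s c N0 z0 p_gt1 s0 c0 sr spr fE FE).
rewrite lee_fin ler_pM2r//; apply: ge0_ler_powR; rewrite ?nnegrE ?(ltW p_gt0) ?(ltW W0)//.
by apply: le_trans WE; exact: ltW.
Qed.

Lemma near_maximal_average (phi : nat -> Rn R n -> R) (eta : R) :
  extremal p Q f F phi -> 0 < eta ->
  \forall k \near \oo, ((F * om `^ p - eta)%:E <= maximal_average p Q (phi k))%E.
Proof.
move=> [_ phi_lim] eta0.
have om0 : 0 < om by exact: lt_trans om_gt1.
(* The target for [W^p]. Half of [eta / F] keeps the final inequality strict; the maximum with [0]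
   makes [b] a legitimate base for the [p]-th root. *)
pose b := Num.max 0 (om `^ p - eta / F / 2).
have b0 : 0 <= b by rewrite le_max lexx.
have eF : 0 < eta / F by rewrite divr_gt0.
have bom : b `^ p^-1 < om.
  rewrite -[ltRHS](powRr1 (ltW om0)) -(@divff _ p) ?gt_eqF// powRrM.
  apply: gt0_ltr_powR; rewrite ?nnegrE ?invr_gt0 ?powR_ge0//.
  by rewrite gt_max powR_gt0//=; lra.
pose W := Num.max ((1 + om) / 2) (b `^ p^-1).
have W1 : 1 < W.
  by rewrite lt_max; apply/orP; left; rewrite ltr_pdivlMr//; move: om_gt1; lra.
have Wom : W < om.
  by rewrite gt_max bom andbT ltr_pdivrMr//; move: om_gt1; lra.
have bW : b <= W `^ p.
  rewrite -[leLHS](powRr1 b0) -(@mulVf _ p) ?gt_eqF// powRrM.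
  apply: ge0_ler_powR; rewrite ?nnegrE ?(ltW p_gt0) ?powR_ge0//.
    by rewrite (le_trans _ (ltW W1)).
  by rewrite le_max lexx orbT.
have lt_bellman : ((F * om `^ p - eta)%:E < bellman p Q f F)%E.
  apply: lt_le_trans (bellman_ge_lt W1 Wom); rewrite lte_fin.
  apply: (@lt_le_trans _ _ (b * F)); last by rewrite ler_pM2r.
  apply: (@lt_le_trans _ _ ((om `^ p - eta / F / 2) * F)).
    have -> : (om `^ p - eta / F / 2) * F = F * om `^ p - eta / 2.
      by field; rewrite gt_eqF.
    by lra.
  by rewrite ler_pM2r// le_max lexx orbT.
have nb : nbhs (bellman p Q f F) [set y | ((F * om `^ p - eta)%:E < y)%E].
  by apply: open_nbhs_nbhs; split; [exact: open_ereal_gt_ereal|exact: lt_bellman].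
have : \forall k \near \oo, ((F * om `^ p - eta)%:E < maximal_average p Q (phi k))%E.
  exact: (phi_lim _ nb).
by apply: filterS => k /ltW.
Qed.

End bellman_lower_bound.

(** * Extremal sequences *)

Section extremal_weak.
Variables (R : realType) (n : nat) (p f F : R) (N0 : nat) (z0 : 'I_n -> int).
Hypotheses (n_gt0 : (0 < n)%N) (p_gt1 : 1 < p) (f_gt0 : 0 < f) (fF : f `^ p <= F).
Local Notation mu := (@lebesgue R n : {measure set (Rn R n) -> \bar R}).
Local Notation Q := (@dyadic_cube R n N0 z0).

Let p_gt0 : 0 < p. Proof. exact: lt_trans p_gt1. Qed.

Lemma extremal_mean (phi : nat -> Rn R n -> R) ws : extremal p Q f F phi ->
  mean (phi k) (N0 + size ws) (descend z0 ws) @[k --> \oo] --> f.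
Proof.
move=> ext; have [adm _] := ext.
have fp0 : 0 < f `^ p by rewrite powR_gt0.
have F0 : 0 < F by exact: lt_le_trans fF.
have [|om om1 omE] := @H_p_surj R p p_gt1 (f `^ p / F).
  by rewrite divr_gt0//= ler_pdivrMr// mul1r.
have fE : f `^ p = F * H_p p om by rewrite omE mulrC divfK// gt_eqF.
apply: (@cvg_mean R n p f F om N0 z0 p_gt1 phi adm om1 fE) => eta eta0.
have [om_gt1|om_le1] := ltP 1 om.
  by apply: filterS (near_maximal_average n_gt0 p_gt1 f_gt0 F0 om_gt1 fE ext eta0) => k.
by apply: nearW => k.
Qed.

Lemma admissible_powR_integrable phi : admissible p Q f F phi ->
  powR_integrable mu Q p phi.
Proof.
move=> adm; have mphi := admissible_meas adm.
split; first exact: measurable_funTS.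
apply/integrableP; split.
  exact/measurable_EFinP/measurable_powR_norm/measurable_funTS.
rewrite (@eq_integral _ _ _ mu _ (fun x => (phi x `^ p)%:E)).
  by rewrite (admissible_intp adm) ltry.
move=> x _; rewrite gee0_abs ?lee_fin ?powR_ge0// ger0_norm//.
exact: (admissible_ge0 adm).
Qed.

Lemma admissible_integrable phi : admissible p Q f F phi ->
  mu.-integrable setT (EFin \o phi).
Proof.
move=> adm; have mphi := admissible_meas adm.
apply/integrableP; split; first exact/measurable_EFinP.
rewrite (@eq_integral _ _ _ mu _ (fun x => (phi x)%:E)).
  exact: (admissible_fin adm).
by move=> x _; rewrite gee0_abs// lee_fin; exact: (admissible_ge0 adm).
Qed.

(** Both functions are nonnegative, so [|phi - g|] is at most the larger one and its [p]-th power at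
    most [phi^p + g^p]. The bound is uniform along the sequences. *)
Lemma admissible_sub_le phi g : admissible p Q f F phi -> admissible p Q f F g ->
  \int[mu]_(x in Q) (`|phi x - g x| `^ p) <= 2 * (vol R n N0 * F).
Proof.
move=> aphi ag.
have mQ : measurable Q by exact: measurable_dyadic_cube.
have [_ iphi] := admissible_powR_integrable aphi.
have [_ ig] := admissible_powR_integrable ag.
have [_ iB] := powR_integrableB mQ (ltW p_gt0)
  (admissible_powR_integrable aphi) (admissible_powR_integrable ag).
have intE (u : Rn R n -> R) : admissible p Q f F u ->
    \int[mu]_(x in Q) (`|u x| `^ p) = vol R n N0 * F.
  move=> au; rewrite -[RHS]/(fine (vol R n N0 * F)%:E) -(admissible_intp au).
  apply: eq_Rintegral => x _; rewrite ger0_norm//; exact: (admissible_ge0 au).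
apply: (@le_trans _ _ (\int[mu]_(x in Q) (`|phi x| `^ p + `|g x| `^ p))).
  apply: le_Rintegral => //; first exact: (integrableD mQ iphi ig).
  move=> x _; have phi0 := admissible_ge0 aphi x; have g0 := admissible_ge0 ag x.
  rewrite (ger0_norm phi0) (ger0_norm g0).
  have /orP[h|h] := le_total (phi x) (g x).
    apply: ler_wpDl; first exact: powR_ge0.
    by apply: ge0_ler_powR; rewrite ?nnegrE ?(ltW p_gt0)// ler0_norm; lra.
  apply: ler_wpDr; first exact: powR_ge0.
  by apply: ge0_ler_powR; rewrite ?nnegrE ?(ltW p_gt0)// ger0_norm; lra.
by rewrite RintegralD// !intE// mulr2n mulrDl mul1r.
Qed.

End extremal_weak.

Theorem corollary2 (R : realType) (n : nat) (n_gt0 : (0 < n)%N)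
    (p q : R) (p_gt1 : 1 < p) (pq : p^-1 + q^-1 = 1)
    (Q : set (Rn R n)) (dQ : is_dyadic_cube Q)
    (f F : R) (f_gt0 : 0 < f) (fF : f `^ p <= F)
    (phi g : nat -> Rn R n -> R)
    (phi_ext : extremal p Q f F phi) (g_ext : extremal p Q f F g)
    (h : Rn R n -> R) (hq : h \_ Q \in Lfun (@lebesgue R n) q%:E) :
  (\int[@lebesgue R n]_(u in Q) ((phi k u - g k u) * h u)%:E)%E
    @[k --> \oo] --> 0%E.
Proof.
have [N0 [z0 QE]] := dQ; subst Q.
have p_gt0 : 0 < p by exact: lt_trans p_gt1.
have q_inv : q^-1 = 1 - p^-1 by rewrite -pq addrAC subrr add0r.
have q_gt0 : 0 < q by rewrite -invr_gt0 q_inv subr_gt0 invf_lt1.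
have q_ge1 : 1 <= q by rewrite -invf_le1// q_inv gerBl invr_ge0 ltW.
pose mu := (@lebesgue R n : {measure set (Rn R n) -> \bar R}).
set Q := dyadic_cube N0 z0 in phi_ext g_ext hq dQ *.
have mQ : measurable Q by exact: measurable_dyadic_cube.
have [aphi _] := phi_ext; have [ag _] := g_ext.
pose psi k x := phi k x - g k x.
have ipsi k : powR_integrable mu Q p (psi k).
  apply: (powR_integrableB mQ (ltW p_gt0)).
    exact: (admissible_powR_integrable (aphi k)).
  exact: (admissible_powR_integrable (ag k)).
have psiK k : \int[mu]_(x in Q) (`|psi k x| `^ p) <= 2 * (vol R n N0 * F).
  exact: (admissible_sub_le p_gt1 (aphi k) (ag k)).
have null ws : \int[mu]_(x in dyadic_cube (N0 + size ws) (descend z0 ws)) psi k x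
    @[k --> \oo] --> 0.
  set J := dyadic_cube _ _; have mJ : measurable J by exact: measurable_dyadic_cube.
  (* On a subcube the integral of the difference is the volume times a difference of averages, both
     tending to [f]. *)
  have -> : (fun k => \int[mu]_(x in J) psi k x) = (fun k => vol R n (N0 + size ws) *
      (mean (phi k) (N0 + size ws) (descend z0 ws) - mean (g k) (N0 + size ws) (descend z0 ws))).
    apply/funext => k; rewrite mulrBr !vol_mean RintegralB//.
    - exact: (integrableS measurableT mJ (@subsetT _ _) (admissible_integrable (aphi k))).
    - exact: (integrableS measurableT mJ (@subsetT _ _) (admissible_integrable (ag k))).
  have lphi := extremal_mean n_gt0 p_gt1 f_gt0 fF ws phi_ext.
  have lg := extremal_mean n_gt0 p_gt1 f_gt0 fF ws g_ext.
  rewrite -(mulr0 (vol R n (N0 + size ws))) -(subrr f).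
  exact: (cvgM (cvg_cst _) (cvgB lphi lg)).
have ih : powR_integrable mu Q q h.
  have mh : measurable_fun Q h.
    apply/(measurable_restrictT _ mQ); have := sub_Lfun_mfun hq.
    by rewrite inE.
  split=> //; have := integrableS measurableT mQ (@subsetT _ _) (Lfun_integrable q_ge1 hq).
  by apply: eq_integrable => // x xQ; rewrite patchE xQ.
have wn := weak_null_dyadic p_gt0 q_gt0 pq ipsi psiK null ih.
rewrite (_ : (fun k => _) = fun k => (\int[mu]_(u in Q) (psi k u * h u))%:E).
  by apply: cvg_EFin; [exact: nearW|exact: wn].
apply/funext => k; rewrite fineK//.
exact: (integrable_fin_num mQ (weak_integrable mQ p_gt0 q_gt0 pq ipsi k ih)).
Qed.
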